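(* Assume (A1), (A2), (K1) and let $m\in(0,1)$. Let $u$ be a nonnegative weak dual solution (WDS) of (CDP) with $u_0\in L^1_{\Phi_1}(\Omega)$, and let $T>0$ be its extinction time. Then $$\|u(t)\|_{L^1_{\Phi_1}(\Omega)}\le\mathsf c_1(T-t)^{\frac1{1-m}}\qquad\forall\,0\le t<T,$$ with $\mathsf c_1=\lambda_1^{\frac1{1-m}}\|\Phi_1\|_1$. As a consequence, the extinction time satisfies the lower bound $$T\ge\lambda_1^{-1}\left(\frac{\|u_0\|_{L^1_{\Phi_1}(\Omega)}}{\|\Phi_1\|_1}\right)^{1-m}.$$
   Context: Setting: $\Omega\subset\mathbb R^N$ ($N\ge1$) is a bounded domain with smooth boundary (at least $C^{2,\alpha}$), $s\in(0,1]$, $N>2s$, and $u^m:=|u|^{m-1}u$. $\mathcal L:\mathrm{dom}(\mathcal L)\subseteq L^1(\Omega)\to L^1(\Omega)$ is a densely defined linear (possibly nonlocal) operator, self-adjoint and nonnegative on $L^2(\Omega)$. (A1): $\mathcal L$ is $m$-accretive in $L^1(\Omega)$. (A2): if $0\le f\le1$ then $0\le e^{-t\mathcal L}f\le1$ for all $t\ge0$. $\mathcal L$ has an inverse $\mathcal L^{-1}:L^1(\Omega)\to L^1(\Omega)$, $\mathcal L^{-1}f(x)=\int_\Omega G_\Omega(x,y)f(y)\,dy$. (K1): there is $c_{1,\Omega}>0$ with $0\le G_\Omega(x,y)\le c_{1,\Omega}|x-y|^{-(N-2s)}$ for a.e. $x,y\in\Omega$. Under (K1), $\mathcal L$ has a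 first eigenpair $(\lambda_1,\Phi_1)$ with $\lambda_1>0$, $0\le\Phi_1\in L^\infty(\Omega)$, $\|\Phi_1\|_2=1$. $L^1_{\Phi_1}(\Omega)$ has norm $\|f\|_{L^1_{\Phi_1}(\Omega)}=\int_\Omega|f|\Phi_1dx$. (CDP): $\partial_tu=-\mathcal Lu^m$ on $(0,\infty)\times\Omega$, $u=0$ on the lateral boundary, $u(0,\cdot)=u_0$. Weak dual solution (WDS): for $T'>0$, $u\in C((0,T'):L^1_{\Phi_1}(\Omega))$ with $u^m\in L^1([0,T']:L^1_{\Phi_1}(\Omega))$ is a WDS of the equation if $\int_0^{T'}\int_\Omega\mathcal L^{-1}u\,\partial_t\psi\,dx\,dt=\int_0^{T'}\int_\Omega u^m\psi\,dx\,dt$ for all $\psi$ with $\psi/\Phi_1\in C^1_c((0,T'):L^\infty(\Omega))$; it is a WDS of (CDP) with initial datum $u_0\in L^1_{\Phi_1}(\Omega)$ if moreover $u\in C([0,T'):L^1_{\Phi_1}(\Omega))$ and $\|u(t)-u_0\|_{L^1_{\Phi_1}}\to0$ as $t\to0^+$. Extinction time: the smallest $T\ge0$ such that $u(t)=0$ a.e. in $\Omega$ for all $t\ge T$ (assumed finite). *)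

(* Defs.v *)
From HB Require Import structures.
From mathcomp Require Import all_boot all_order all_algebra.
From mathcomp Require Import all_classical all_reals all_analysis.

Set Implicit Arguments.
Unset Strict Implicit.
Unset Printing Implicit Defensive.

Import Order.TTheory GRing.Theory Num.Theory.
Import numFieldNormedType.Exports.

Local Open Scope classical_set_scope.
Local Open Scope ring_scope.

Definition rV_display : measure_display.
Proof. exact: default_measure_display. Qed.

(* Row vectors carry the product sigma-algebra, i.e. the one generated by the
   n coordinate maps. *)
Section measurable_rV.
Context {R : realType} (n : nat).

Let coord : 'I_n -> 'rV[R]_n -> measurableTypeR R := fun i x => x ord0 i.

Let rV_set0 : g_sigma_preimage coord set0.
Proof. exact: sigma_algebra0. Qed.

Let rV_setC A : g_sigma_preimage coord A -> g_sigma_preimage coord (~` A).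
Proof. exact: sigma_algebraC. Qed.

Let rV_bigcup (F : _^nat) : (forall i, g_sigma_preimage coord (F i)) ->
  g_sigma_preimage coord (\bigcup_i (F i)).
Proof. exact: sigma_algebra_bigcup. Qed.

HB.instance Definition _ := @isMeasurable.Build rV_display 'rV[R]_n
  (g_sigma_preimage coord) rV_set0 rV_setC rV_bigcup.

Lemma measurable_coord (i : 'I_n) :
  measurable_fun [set: 'rV[R]_n] (fun x => x ord0 i : measurableTypeR R).
Proof.
move=> _ Y mY; rewrite setTI; apply: sub_sigma_algebra => /=.
rewrite -bigcup_seq/=; exists i => /=; first by rewrite mem_index_enum.
by exists Y => //; rewrite setTI.
Qed.

Lemma measurable_fun_rVP d (T : measurableType d) (f : T -> 'rV[R]_n) :
  (forall i, measurable_fun [set: T] (fun t => f t ord0 i : measurableTypeR R)) ->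
  measurable_fun [set: T] f.
Proof.
move=> mf.
suff: g_sigma_preimage (fun i => coord i \o f) `<=` measurable.
  move=> H _ A mA; apply: H; rewrite g_sigma_preimage_comp.
  by exists A.
apply: smallest_sub; first exact: sigma_algebra_measurable.
rewrite -bigcup_seq => A [i _ [B mB <-]]; exact: mf.
Qed.

End measurable_rV.

Definition rV_cons {R : realType} {n : nat}
  (p : measurableTypeR R * 'rV[R]_n) : 'rV[R]_n.+1 := row_mx (p.1)%:M p.2.

Lemma rV_consE0 (R : realType) (n : nat) (p : measurableTypeR R * 'rV[R]_n) :
  rV_cons p ord0 ord0 = p.1.
Proof.
rewrite /rV_cons (_ : ord0 = lshift n (@ord0 0)); last exact/val_inj.
by rewrite [LHS]row_mxEl !mxE eqxx mulr1n.
Qed.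

Lemma rV_consES (R : realType) (n : nat) (p : measurableTypeR R * 'rV[R]_n)
    (i : 'I_n) : rV_cons p ord0 (lift ord0 i) = p.2 ord0 i.
Proof.
rewrite /rV_cons (_ : lift ord0 i = rshift 1 i); last exact/val_inj.
by rewrite [LHS]row_mxEr.
Qed.

Lemma measurable_rV_cons (R : realType) (n : nat) :
  measurable_fun [set: measurableTypeR R * 'rV[R]_n] (@rV_cons R n).
Proof.
apply: measurable_fun_rVP => i.
case: (unliftP ord0 i) => [j|] ->.
  under eq_fun do rewrite rV_consES.
  exact: (measurableT_comp (@measurable_coord R n j) measurable_snd).
under eq_fun do rewrite rV_consE0.
exact: measurable_fst.
Qed.

Section lebesgue_rV.
Context {R : realType}.

Section step.
Context (n : nat) (mu : {sigma_finite_measure set 'rV[R]_n -> \bar R}).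

Definition lebesgue_rV_step : set 'rV[R]_n.+1 -> \bar R :=
  pushforward (@lebesgue_measure R \x mu)%E (@rV_cons R n).

Let step0 : lebesgue_rV_step set0 = 0%E.
Proof. by rewrite /lebesgue_rV_step /pushforward preimage_set0 measure0. Qed.

Let step_ge0 A : (0 <= lebesgue_rV_step A)%E.
Proof. by rewrite /lebesgue_rV_step /pushforward; exact: measure_ge0. Qed.

Let step_sigma_additive : semi_sigma_additive lebesgue_rV_step.
Proof.
move=> F mF tF mUF; rewrite /lebesgue_rV_step /pushforward preimage_bigcup.
have mpre A : measurable A -> measurable (@rV_cons R n @^-1` A).
  by move=> mA; rewrite -[X in measurable X]setTI; exact: measurable_rV_cons.
apply: measure_semi_sigma_additive.
- by move=> k; exact: mpre.
- apply/trivIsetP => /= i j _ _ ij; rewrite -preimage_setI.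
  by move/trivIsetP : tF => /(_ _ _ _ _ ij) ->//; rewrite preimage_set0.
- by rewrite -preimage_bigcup; exact: mpre.
Qed.

HB.instance Definition _ := isMeasure.Build _ _ _ lebesgue_rV_step
  step0 step_ge0 step_sigma_additive.

Let step_sigma_finite : sigma_finite setT lebesgue_rV_step.
Proof.
have /sigma_finiteP[F [TF ndF Foo]] := sigma_finiteT (@lebesgue_measure R).
have /sigma_finiteP[G [TG ndG Goo]] := sigma_finiteT mu.
pose uncons (x : 'rV[R]_n.+1) : measurableTypeR R * 'rV[R]_n :=
  (x ord0 ord0, \row_i x ord0 (lift ord0 i)).
have consK : cancel (@rV_cons R n) uncons.
  move=> [a v]; rewrite /uncons rV_consE0; congr pair.
  by apply/rowP => i; rewrite mxE rV_consES.
have munc : measurable_fun setT uncons.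
  apply/measurable_fun_pairP; split; first exact: measurable_coord.
  apply: measurable_fun_rVP => i /=.
  under eq_fun do rewrite mxE.
  exact: measurable_coord.
exists (fun k => uncons @^-1` (F k `*` G k)).
  apply/esym; rewrite -subTset => x _ /=.
  have [i _ Fi] : (\bigcup_k F k) (uncons x).1 by rewrite -TF.
  have [j _ Gj] : (\bigcup_k G k) (uncons x).2 by rewrite -TG.
  exists (maxn i j) => //; split.
  - by move: Fi; exact/subsetPset/ndF/leq_maxl.
  - by move: Gj; exact/subsetPset/ndG/leq_maxr.
move=> k; have [mF Fk] := Foo k; have [mG Gk] := Goo k; split.
  rewrite -[X in measurable X]setTI; apply: munc => //.
  exact: measurableX.
rewrite /lebesgue_rV_step /pushforward -comp_preimage.
rewrite (_ : uncons \o _ = id); last by apply/funext => x; exact: consK.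
by rewrite preimage_id product_measure1E// lte_mul_pinfty// ge0_fin_numE.
Qed.

HB.instance Definition _ := Measure_isSigmaFinite.Build _ _ _
  lebesgue_rV_step step_sigma_finite.

End step.

(* Lebesgue measure on R^n : the point mass on R^0, then, for each new
   coordinate, the (push-forward to row vectors of the) product with the
   Lebesgue measure of the line; [lebesgue_rV_box] gives its value on boxes. *)
Fixpoint lebesgue_rV (n : nat) : {sigma_finite_measure set 'rV[R]_n -> \bar R} :=
  match n with
  | 0 => dirac (0 : 'rV[R]_0)
  | n'.+1 => lebesgue_rV_step (lebesgue_rV n')
  end.

Lemma lebesgue_rV_box (n : nat) (A : 'I_n -> set R) :
  (forall i, measurable (A i)) ->
  lebesgue_rV n [set x | forall i, A i (x ord0 i)] =
  (\prod_(i < n) lebesgue_measure (A i))%E.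
Proof.
elim: n A => [|n IHn] A mA.
  rewrite big_ord0 /= diracE mem_set// => -[]//.
rewrite big_ord_recl.
pose B := [set x : 'rV[R]_n | forall i : 'I_n, A (lift ord0 i) (x ord0 i)].
have mB : measurable B.
  rewrite (_ : B = \bigcap_(i in [set: 'I_n])
    ((fun x : 'rV[R]_n => x ord0 i : measurableTypeR R) @^-1` (A (lift ord0 i)))).
    apply: fin_bigcap_measurable => // i _.
    by rewrite -[X in measurable X]setTI; apply: measurable_coord => //; exact: mA.
  by apply/seteqP; split=> [x Ax i _|x Ax i]; exact: Ax.
transitivity ((lebesgue_measure \x lebesgue_rV n)%E (A ord0 `*` B)); last first.
  apply: etrans (product_measure1E _ _ _ mB) _; first exact: mA.
  congr (_ * _)%E.
  exact: (IHn (fun i => A (lift ord0 i))).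
rewrite /= /lebesgue_rV_step /pushforward.
congr ((_ \x _)%E _); apply/seteqP; split=> [[a v] /= Av|[a v] /= [Aa Av] i].
  by split=> [|i]; [have := Av ord0; rewrite rV_consE0|
    have := Av (lift ord0 i); rewrite rV_consES].
by case: (unliftP ord0 i) => [j|] ->; rewrite ?rV_consE0 ?rV_consES.
Qed.

End lebesgue_rV.

Section domain.
Context {R : realType}.

(* The library's norm on row vectors is the sup norm, hence this one. *)
Definition eucl_norm (n : nat) (x : 'rV[R]_n) : R :=
  Num.sqrt (\sum_(i < n) x ord0 i ^+ 2).

Definition C2_hoelder (n : nat) (alpha : R) (g : 'rV[R]_n -> R) : Prop :=
  let e (i : 'I_n) : 'rV[R]_n := delta_mx ord0 i in
  [/\ forall x i, derivable g x (e i),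
      forall x i j, derivable ('D_(e i) g) x (e j) &
      exists C : R, forall i j x y,
        `|'D_(e j) ('D_(e i) g) x - 'D_(e j) ('D_(e i) g) y|
          <= C * eucl_norm (x - y) `^ alpha].

(* Near each boundary point, after relabelling (the k-th coordinate is singled
   out) and reorienting (the sign) the axes, Omega is the region strictly above
   the graph of a C^{2,alpha} function of the remaining N-1 coordinates. *)
Definition C2_hoelder_boundary (N : nat) (alpha : R) (Omega : set 'rV[R]_N) :=
  forall x0, (closure Omega `\` interior Omega) x0 ->
  exists (r : R) (k : 'I_N) (b : bool) (g : 'rV[R]_(N.-1) -> R),
    [/\ 0 < r, C2_hoelder alpha g &
        forall x, eucl_norm (x - x0) < r ->
          (Omega x <-> g (col' k x) < (-1) ^+ b * x ord0 k)].

Definition bounded_C2_hoelder_domain (N : nat) (alpha : R)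
    (Omega : set 'rV[R]_N) : Prop :=
  [/\ open Omega, connected Omega, Omega !=set0, bounded_set Omega &
      C2_hoelder_boundary alpha Omega].

Definition K1 (N : nat) (s : R) (Omega : set 'rV[R]_N)
    (G : 'rV[R]_N -> 'rV[R]_N -> R) : Prop :=
  exists c : R, 0 < c /\
    \forall z \ae (lebesgue_rV N \x lebesgue_rV N)%E,
      Omega z.1 -> Omega z.2 ->
      0 <= G z.1 z.2 <= c * eucl_norm (z.1 - z.2) `^ (- (N%:R - 2 * s)).

End domain.

(* Functions on D are functions on the ambient type T of which only the values
   in D matter, and elements of L^p(D) are represented by functions, equality
   being equality a.e. in D.  The norms below are real-valued: they carry
   information only together with the corresponding membership. *)
Section evolution.
Context d (T : measurableType d) (R : realType).
Variables (mu : {sigma_finite_measure set T -> \bar R}) (D : set T).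

Definition Lp (p : \bar R) : set (T -> R) := [set f | f \_ D \in Lfun mu p].

Definition pnorm (p : \bar R) (f : T -> R) : R :=
  fine ('N[mu]_p[EFin \o (f \_ D)])%E.

Definition inner (f g : T -> R) : R := \int[mu]_(x in D) (f x * g x).

Section operator.
Variables (dom : set (T -> R)) (L : (T -> R) -> (T -> R)).

Definition densely_defined_operator : Prop :=
  [/\ forall f, dom f -> Lp 1 f /\ Lp 1 (L f),
      forall f g, dom f -> Lp 1 g -> f = g %[ae mu in D] ->
        dom g /\ L f = L g %[ae mu in D],
      forall (a : R) f g, dom f -> dom g ->
        dom (fun x => a * f x + g x) /\
        L (fun x => a * f x + g x) = (fun x => a * L f x + L g x) %[ae mu in D] &
      forall f, Lp 1 f -> forall e : R, 0 < e ->
        exists2 g, dom g & pnorm 1 (f \- g) < e].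

(* The realization of L on L^2 is its part in L^2. *)
Definition dom2 : set (T -> R) :=
  [set f | [/\ dom f, Lp 2%:E f & Lp 2%:E (L f)]].

(* The second clause says that the L^2-realization has the same graph as its
   adjoint. *)
Definition selfadjoint_nonneg : Prop :=
  [/\ forall f, Lp 2%:E f -> forall e : R, 0 < e ->
        exists2 g, dom2 g & pnorm 2%:E (f \- g) < e,
      forall g h, Lp 2%:E g -> Lp 2%:E h ->
        (forall f, dom2 f -> inner (L f) g = inner f h) <->
        (dom2 g /\ L g = h %[ae mu in D]) &
      forall f, dom2 f -> 0 <= inner (L f) f].

Definition m_accretive : Prop := forall l : R, 0 < l ->
  (forall f, dom f -> pnorm 1 f <= pnorm 1 (fun x => f x + l * L f x)) /\
  (forall g, Lp 1 g ->
     exists2 f, dom f & (fun x => f x + l * L f x) = g %[ae mu in D]).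

Definition contraction_semigroup (S : R -> (T -> R) -> (T -> R)) : Prop :=
  [/\ forall t f, 0 <= t -> Lp 1 f ->
        Lp 1 (S t f) /\ pnorm 1 (S t f) <= pnorm 1 f,
      forall t (a : R) f g, 0 <= t -> Lp 1 f -> Lp 1 g ->
        S t (fun x => a * f x + g x) = (fun x => a * S t f x + S t g x)
          %[ae mu in D],
      forall f, Lp 1 f -> S 0 f = f %[ae mu in D],
      forall t r f, 0 <= t -> 0 <= r -> Lp 1 f ->
        S (t + r) f = S t (S r f) %[ae mu in D] &
      forall f, Lp 1 f -> (fun h => pnorm 1 (S h f \- f)) @ 0^'+ --> (0 : R)].

(* S t = e^{-tL} : the infinitesimal generator of S is -L, domain included. *)
Definition generated_by_opp (S : R -> (T -> R) -> (T -> R)) : Prop :=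
  forall f g, Lp 1 f -> Lp 1 g ->
    (dom f /\ L f = g %[ae mu in D]) <->
    (fun h => pnorm 1 (fun x => (f x - S h f x) / h - g x)) @ 0^'+ --> (0 : R).

(* The semigroup below exists and is unique for a densely defined m-accretive
   L (Hille-Yosida), so the existential only gives it a name. *)
Definition sub_markovian : Prop :=
  exists S, [/\ contraction_semigroup S, generated_by_opp S &
    forall f t, Lp 1 f -> 0 <= t ->
      (\forall x \ae mu, D x -> 0 <= f x <= 1) ->
      (\forall x \ae mu, D x -> 0 <= S t f x <= 1)].

Definition kernel_op (G : T -> T -> R) (f : T -> R) : T -> R :=
  fun x => \int[mu]_(y in D) (G x y * f y).

Definition inverse_kernel (G : T -> T -> R) : Prop :=
  [/\ measurable_fun (D `*` D) (fun z : T * T => G z.1 z.2),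
      forall f, Lp 1 f -> [/\ dom (kernel_op G f) &
        L (kernel_op G f) = f %[ae mu in D]] &
      forall f, dom f -> kernel_op G (L f) = f %[ae mu in D]].

Definition first_eigenpair (lam : R) (Phi : T -> R) : Prop :=
  [/\ 0 < lam,
      dom Phi /\ L Phi = (fun x => lam * Phi x) %[ae mu in D],
      Lp +oo%E Phi /\ \forall x \ae mu, D x -> 0 <= Phi x,
      pnorm 2%:E Phi = 1 &
      forall (l : R) phi, dom2 phi -> pnorm 2%:E phi != 0 ->
        L phi = (fun x => l * phi x) %[ae mu in D] -> lam <= l].

End operator.

Section weak_dual.
Variables (m : R) (G : T -> T -> R) (Phi : T -> R).

Definition L1w : set (T -> R) :=
  [set f : T -> R | measurable_fun D f /\ Lp 1 (f \* Phi)].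

Definition wnorm (f : T -> R) : R := \int[mu]_(x in D) (`|f x| * Phi x).

Definition spow (r : R) : R := `|r| `^ (m - 1) * r.

Definition continuous_L1w (I : set R) (v : R -> T -> R) : Prop :=
  forall t, I t -> L1w (v t) /\
    (fun r => wnorm (v r \- v t)) @ within I (nbhs t) --> (0 : R).

(* a.e. in time limit of simple functions with values in L^1_Phi *)
Definition strongly_measurable_L1w (I : set R) (v : R -> T -> R) : Prop :=
  exists (p : nat -> nat) (A : nat -> nat -> set (measurableTypeR R))
      (c : nat -> nat -> T -> R),
    (forall n k, measurable (A n k) /\ L1w (c n k)) /\
    \forall t \ae (@lebesgue_measure R), I t -> L1w (v t) /\
      (fun n => wnorm (fun x => v t x - \sum_(k < p n) \1_(A n k) t * c n k x))
        @ \oo --> (0 : R).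

Definition bochner_L1_L1w (I : set R) (v : R -> T -> R) : Prop :=
  strongly_measurable_L1w I v /\
  (@lebesgue_measure R).-integrable I (fun t => (wnorm (v t))%:E).

(* eta in C^1_c((0,T');L^oo(D)), extended by zero, with time derivative deta *)
Definition C1c_Loo (T' : R) (eta deta : R -> T -> R) : Prop :=
  [/\ forall t, Lp +oo%E (eta t) /\ Lp +oo%E (deta t),
      forall t, (fun h => pnorm +oo%E
        (fun x => (eta (t + h) x - eta t x) / h - deta t x)) @ 0^' --> (0 : R),
      forall t, (fun r => pnorm +oo%E (deta r \- deta t)) @ t --> (0 : R) &
      exists a b : R, [/\ 0 < a, b < T' &
        forall t, ~~ (a <= t <= b) -> eta t = (fun=> 0) %[ae mu in D]]].

(* A test function psi is given through eta = psi / Phi: psi = eta * Phi and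
   d_t psi = deta * Phi. *)
Definition weak_dual_solution (T' : R) (u : R -> T -> R) : Prop :=
  [/\ continuous_L1w `]0, T'[ u,
      bochner_L1_L1w `[0, T'] (fun t x => spow (u t x)) &
      forall eta deta, C1c_Loo T' eta deta ->
        \int[lebesgue_measure]_(t in `]0, T'[)
          \int[mu]_(x in D) (kernel_op G (u t) x * (deta t x * Phi x)) =
        \int[lebesgue_measure]_(t in `]0, T'[)
          \int[mu]_(x in D) (spow (u t x) * (eta t x * Phi x))].

(* The problem is posed on (0,oo), hence the quantification over T'. *)
Definition WDS_CDP (u0 : T -> R) (u : R -> T -> R) : Prop :=
  forall T', 0 < T' ->
    [/\ weak_dual_solution T' u, continuous_L1w `[0, T'[ u &
        (fun t => wnorm (u t \- u0)) @ 0^'+ --> (0 : R)].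

End weak_dual.

Definition extinction_time (u : R -> T -> R) (Te : R) : Prop :=
  let extinct_from t0 :=
    0 <= t0 /\ forall t, t0 <= t -> u t = (fun=> 0) %[ae mu in D] in
  extinct_from Te /\ forall t0, extinct_from t0 -> Te <= t0.

End evolution.

(* Main.v *)
(* Let Y(t) be the integral of u(t) Phi1, Z(t) that of u(t)^m Phi1, and P that
   of Phi1.  Self-adjointness tested against Phi1 turns the integral of
   (L^-1 f) Phi1 into lambda1^-1 times that of f Phi1 -- first for bounded f,
   where (K1) puts L^-1 f into the domain of the L^2-realization, then for f >= 0
   by monotone convergence, so that symmetry of the kernel is never needed.
   Testing the equation with chi(t) Phi1 thus gives Y' = - lambda1 Z weakly, and
   Jensen's inequality gives Z <= P^(1-m) Y^m.  As Y is nonincreasing and vanishes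
   at T, for 0 < t < T
     Y(t) = lambda1 * int_t^T Z <= lambda1 P^(1-m) (T - t) Y(t)^m,
   which is the claim, without solving the differential inequality. *)

Require Import Defs.
From mathcomp Require Import all_boot all_order all_algebra.
From mathcomp Require Import all_classical all_reals all_analysis.
From mathcomp Require Import measurable_realfun ess_sup_inf ring lra.

Set Implicit Arguments.
Unset Strict Implicit.
Unset Printing Implicit Defensive.

Import Order.TTheory GRing.Theory Num.Theory.
Import numFieldNormedType.Exports.

Local Open Scope classical_set_scope.
Local Open Scope ring_scope.

(** * Lebesgue measure on row vectors *)

(** No time derivative of Y is available: Y is merely continuous for t > 0 and tests are C^1. So chi
    is a smoothed indicator of an interval [a, r], whose derivative is a difference of two averaging
    kernels of mass 1, placed just after a and just after r. Monotonicity of Y, itself read off such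
    averages, then compares an average with a value of Y. The other obstacle is signs and
    finiteness. G, Phi1 and u(t) are nonnegative only a.e., and a real-valued integral that is
    infinite returns 0; hence the Green identity is proved for everywhere nonnegative versions with
    extended-real integrals, and only then brought back. In (K1) the exponent N - 2s lies below N,
    so the integral of G(x, .) is bounded uniformly in x; on a set of finite measure, boundedness of
    L^-1 f then gives square integrability. The constant comes from Y^(1-m) <= lambda1 P^(1-m) (T -
    t), raised to the power 1/(1-m). *)

Lemma rV_ballE (R : realType) (n : nat) (x : 'rV[R]_n) (r : R) : 0 < r ->
  ball x r = [set y : 'rV[R]_n | forall i, ball (x ord0 i) r (y ord0 i)].
Proof.
move=> r0; apply/seteqP; split=> [y [_ xy] i|y xy]; first exact: xy.
by split=> // i j; rewrite (ord1 i).
Qed.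

Lemma measurable_rV_ball (R : realType) (n : nat) (x : 'rV[R]_n) (r : R) :
  measurable (ball x r : set 'rV[R]_n).
Proof.
have [r0|r0] := ltP 0 r; last first.
  rewrite (_ : ball x r = set0)//; apply/seteqP; split=> // y [].
  by rewrite ltNge r0.
rewrite rV_ballE//.
rewrite (_ : [set y | _] = \bigcap_(i in [set: 'I_n])
  ((fun y : 'rV[R]_n => y ord0 i : measurableTypeR R) @^-1` ball (x ord0 i) r)).
  apply: fin_bigcap_measurable => // i _.
  rewrite -[X in measurable X]setTI; apply: measurable_coord => //.
  by rewrite ball_itv; exact: measurable_itv.
by apply/seteqP; split=> [y xy i _|y xy i]; exact: xy.
Qed.

Lemma lebesgue_rV_ball (R : realType) (n : nat) (x : 'rV[R]_n) (r : R) :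
  0 < r -> lebesgue_rV n (ball x r) = ((r *+ 2) ^+ n)%:E.
Proof.
move=> r0; rewrite rV_ballE// (lebesgue_rV_box (A := fun i => ball (x ord0 i) r)); last first.
  by move=> i; by rewrite ball_itv; exact: measurable_itv.
under eq_bigr do rewrite lebesgue_measure_ball ?(ltW r0)//.
by rewrite prodEFin prodr_const card_ord.
Qed.

(** The sigma-algebra is generated by the coordinates, not by the open sets, so an open set has to
    be written as a countable union of cubes with rational centres and radii 1/(k+1). [F p] is such
    a cube if it lies in [A], and is empty otherwise. *)
Lemma measurable_rV_open (R : realType) (n : nat) (A : set 'rV[R]_n) :
  open A -> measurable A.
Proof.
move=> oA.
pose c (p : 'rV[rat]_n) : 'rV[R]_n := map_mx ratr p.
pose F (p : 'rV[rat]_n * nat) : set 'rV[R]_n :=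
  [set y | ball (c p.1) p.2.+1%:R^-1 y /\ ball (c p.1) p.2.+1%:R^-1 `<=` A].
have mF p : measurable (F p).
  have [sA|nsA] := pselect (ball (c p.1) p.2.+1%:R^-1 `<=` A).
    rewrite (_ : F p = ball (c p.1) p.2.+1%:R^-1).
      exact: measurable_rV_ball.
    by apply/seteqP; split=> [y []|y].
  rewrite (_ : F p = set0)//.
  by apply/seteqP; split=> // y [].
suff -> : A = \bigcup_p F p.
  by apply: countable_bigcupT_measurable => //; exact: countableP.
apply/seteqP; split=> [x Ax|x [p _ [px]]]; last exact.
have [e /= e0 xeA] : nbhs_ball x A by rewrite nbhs_ballE; exact: open_nbhs_nbhs.
(* Radius below [e / 2]: a cube of this radius that contains [x] stays inside [ball x e]. *)
have [k ke] : exists k : nat, k.+1%:R^-1 < e / 2.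
  have /= [k _ /(_ k (leqnn k))] := near_infty_natSinv_lt (PosNum (divr_gt0 e0 (ltr0Sn _ 1))).
  by move=> /= ?; exists k.
have k0 : 0 < k.+1%:R^-1 :> R by rewrite invr_gt0.
have /choice[p xp] : forall i : 'I_n, exists q : rat,
    ball (x ord0 i) k.+1%:R^-1 (ratr q).
  move=> i; set B := ball _ _.
  have B0 : B !=set0 by exists (x ord0 i); exact: ballxx.
  have [z [Bz [q _ qE]]] := @dense_rat R B B0 (ball_open _ _).
  by exists q; rewrite qE.
have cx : ball (c (\row_i p i)) k.+1%:R^-1 x.
  rewrite rV_ballE// => i; rewrite !mxE; exact/ball_sym.
exists (\row_i p i, k) => //; split => //= y cy.
apply: xeA; rewrite (splitr e); apply: (@ball_triangle _ _ (c (\row_i p i))).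
  by apply: le_ball (ball_sym cx); exact: ltW.
by apply: le_ball cy; exact: ltW.
Qed.

Lemma bounded_set_ball (R : realType) (n : nat) (A : set 'rV[R]_n) :
  bounded_set A -> exists2 r : R, 0 < r &
    forall x y, A x -> A y -> ball x r y.
Proof.
move=> [M [_ AM]]; pose B := `|M| + 1.
have B0 : 0 < B by rewrite ltr_wpDl.
exists (B * 2 + 1); first by rewrite ltr_wpDl// mulr_ge0// ltW.
have {}AM x : A x -> `|x| <= B.
  by apply: AM; rewrite (le_lt_trans (ler_norm M))// ltrDl.
move=> x y Ax Ay; rewrite -ball_normE /=.
rewrite (le_lt_trans (ler_normB _ _))// mulr2n mulrDr mulr1.
by rewrite (le_lt_trans (lerD (AM _ Ax) (AM _ Ay)))// ltrDl.
Qed.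

Lemma lebesgue_rV_bounded (R : realType) (n : nat) (A : set 'rV[R]_n) :
  measurable A -> bounded_set A -> (lebesgue_rV n A < +oo)%E.
Proof.
move=> mA bA; have [r r0 Ar] := bounded_set_ball bA.
have [->|/set0P[x Ax]] := eqVneq A set0; first by rewrite measure0.
apply: (@le_lt_trans _ _ (lebesgue_rV n (ball x r))); last first.
  by rewrite lebesgue_rV_ball// ltry.
apply: le_measure; rewrite ?inE//; first exact: measurable_rV_ball.
by move=> y Ay; exact: Ar.
Qed.

(** * Row integrals of a Riesz kernel, bounded uniformly over a bounded set *)

Lemma mx_norm_le_eucl_norm (R : realType) (n : nat) (x : 'rV[R]_n) :
  `|x| <= eucl_norm x.
Proof.
have [->|x0] := eqVneq x 0; first by rewrite normr0 sqrtr_ge0.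
have [[i j] /= nx] : exists i, `|x| = `|x i.1 i.2|.
  by apply: mx_norm_neq0; rewrite -[mx_norm x]/(`|x|) normr_eq0.
rewrite nx /eucl_norm (ord1 i) /= -sqrtr_sqr.
rewrite ler_sqrt; last by apply: sumr_ge0 => k _; exact: sqr_ge0.
by rewrite (bigD1 j)//= lerDl; apply: sumr_ge0 => k _; exact: sqr_ge0.
Qed.

(** Take the least exponent [k] with [r * 2^-1 ^+ k <= d]; it is not 0 because [d < r], and its
    predecessor is the shell. *)
Lemma dyadic_shell (R : realType) (r d : R) : 0 < d < r ->
  exists k : nat, r * 2^-1 ^+ k.+1 <= d < r * 2^-1 ^+ k.
Proof.
move=> /andP[d0 dr]; have r0 := lt_trans d0 dr.
have [k radk] : exists k : nat, r * 2^-1 ^+ k <= d.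
  have /= [k _ /(_ k (leqnn k))/= kd] :=
    near_infty_natSinv_expn_lt (PosNum (divr_gt0 d0 r0)).
  by exists k; rewrite mulrC -ler_pdivlMr// exprVn ltW// -div1r.
have [[|j] jd jmin] :=
    ex_minnP (ex_intro (fun k : nat => r * 2^-1 ^+ k <= d) k radk).
  by move: jd; rewrite expr0 mulr1 leNgt dr.
by exists j; rewrite jd ltNge; apply/negP => /jmin; rewrite ltnn.
Qed.

(** Kernel value at the inner radius of the k-th shell times the volume of the outer cube: a
    geometric sequence of ratio 2^(b - n). *)
Lemma dyadic_weight (R : realType) (r b c : R) (n k : nat) : 0 < r ->
  c * (r * 2^-1 ^+ k.+1) `^ (- b) * ((r * 2^-1 ^+ k) *+ 2) ^+ n =
  c * (r / 2) `^ (- b) * (r *+ 2) ^+ n * (2^-1 `^ (- b) * 2^-1 ^+ n) ^+ k.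
Proof.
move=> r0; have -> : r * 2^-1 ^+ k.+1 = r / 2 * 2^-1 ^+ k by rewrite exprS mulrA.
rewrite -mulrnAl powRM ?divr_ge0 ?exprn_ge0 ?invr_ge0 ?(ltW r0)//.
rewrite -[in X in c * (_ * X)]powR_mulrn ?invr_ge0// powRAC.
rewrite powR_mulrn ?powR_ge0// !exprMn -!exprM mulnC; ring.
Qed.

(* The kernel is dominated by a step function on dyadic cubes; its value at y = x
   is 0 because powR 0 (- b) = 0. *)
Lemma riesz_kernel_bound (R : realType) (n : nat) (b c : R) (D : set 'rV[R]_n) :
  0 < b < n%:R -> 0 <= c -> measurable D -> bounded_set D ->
  exists M : R, forall x (f : 'rV[R]_n -> \bar R), D x ->
    measurable_fun setT f -> (forall y, (0 <= f y)%E) ->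
    (\forall y \ae lebesgue_rV n,
      D y -> (f y <= (c * eucl_norm (x - y) `^ (- b))%:E)%E) ->
    (\int[lebesgue_rV n]_(y in D) f y <= M%:E)%E.
Proof.
move=> /andP[b0 bn] c0 mD bD; have [r r0 Dr] := bounded_set_ball bD.
pose rad (k : nat) := r * 2^-1 ^+ k.
have rad0 k : 0 < rad k by rewrite mulr_gt0// exprn_gt0// invr_gt0.
pose w (k : nat) := c * rad k.+1 `^ (- b).
have w0 k : 0 <= w k by rewrite mulr_ge0// powR_ge0.
pose a := c * (r / 2) `^ (- b) * (r *+ 2) ^+ n.
pose q : R := 2^-1 `^ (- b) * 2^-1 ^+ n.
have a0 : 0 <= a.
  by rewrite mulr_ge0 ?mulr_ge0 ?powR_ge0// exprn_ge0// mulrn_wge0// ltW.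
have q0 : 0 < q by rewrite mulr_gt0 ?powR_gt0 ?exprn_gt0// invr_gt0.
(* Since [q] is 2^(b - n), this is where [b < n] makes the singularity integrable. *)
have q1 : `|q| < 1.
  rewrite gtr0_norm// /q -powR_mulrn ?invr_ge0// -powRD; last first.
    by rewrite invr_eq0 pnatr_eq0 implybT.
  have bn0 : 0 < n%:R - b by rewrite subr_gt0.
  have := gt0_ltr_powR bn0 (_ : 2^-1 \in Num.nneg) (_ : 1 \in Num.nneg).
  rewrite powR1 addrC; apply; rewrite ?nnegrE ?invr_ge0//.
  by rewrite invf_lt1// ltr1n.
have wq k : w k * (rad k *+ 2) ^+ n = a * q ^+ k.
  exact: dyadic_weight.
(* The sum of the geometric series; [D] enters only through [r], so the bound does not depend on
   [x]. *)
exists (a / (1 - q)) => x f Dx mf f0 fle.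
pose g k (y : 'rV[R]_n) : \bar R := (w k * \1_(ball x (rad k)) y)%:E.
have mg k : measurable_fun D (g k).
  apply/measurable_EFinP/measurable_funM => //.
  by apply: measurable_indic; exact: measurable_rV_ball.
have g0 k y : (0 <= g k y)%E by rewrite lee_fin mulr_ge0.
apply: (@le_trans _ _ (\int[lebesgue_rV n]_(y in D) \big[+%E/0%E]_(0 <= k <oo) g k y)%E).
  apply: ae_ge0_le_integral => //.
  - by apply: measurable_funS mf.
  - by move=> y Dy; exact: nneseries_ge0.
  - by apply: ge0_emeasurable_sum => // k y Dy _.
  move: fle; apply: filterS => y fy Dy; apply: (le_trans (fy Dy)).
  have [xy|xy] := eqVneq (x - y) 0.
    rewrite xy /eucl_norm big1 ?sqrtr0 ?powR0 ?mulr0 ?oppr_eq0 ?gt_eqF//.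
      exact: nneseries_ge0.
    by move=> i _; rewrite mxE expr0n.
  have d0 : 0 < `|x - y| by rewrite normr_gt0.
  have dr : `|x - y| < r by have := Dr _ _ Dx Dy; rewrite -ball_normE.
  (* The inner radius [rad k.+1] bounds the kernel on the shell, the outer radius [rad k] puts [y]
     into the cube of [g k]; one term of the series is already enough. *)
  have [k /andP[kd dk]] : exists k, rad k.+1 <= `|x - y| < rad k.
    by apply: dyadic_shell; rewrite d0.
  apply: (@le_trans _ _ (g k y)).
    rewrite lee_fin /g indicE mem_set ?mulr1; last by rewrite -ball_normE.
    (* The kernel decreases in the Euclidean norm while the shells are cut with the sup norm, which
       is the smaller one: the comparison goes the right way. *)
    rewrite ler_wpM2l// !powRN lef_pV2 ?posrE ?powR_gt0//; last first.
      exact: lt_le_trans (mx_norm_le_eucl_norm _).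
    rewrite ge0_ler_powR ?nnegrE ?(ltW b0) ?(ltW (rad0 _)) ?sqrtr_ge0//.
    exact: le_trans (mx_norm_le_eucl_norm _).
  apply: le_trans (nneseries_lim_ge k.+1 _) => //.
  rewrite big_nat_recr//= leeDr//; exact: sume_ge0.
rewrite integral_nneseries//.
apply: lime_le; first by apply: is_cvg_nneseries => k _ _; exact: integral_ge0.
apply: nearW => m; apply: (@le_trans _ _ (\sum_(0 <= k < m) (a * q ^+ k)%:E)%E).
  apply: lee_sum => k _.
  rewrite (_ : (fun y => g k y) = (fun y => (w k)%:E * (\1_(ball x (rad k)) y)%:E)%E)//.
  rewrite ge0_integralZl ?lee_fin//; last first.
    by apply/measurable_EFinP; apply: measurable_indic; exact: measurable_rV_ball.
  rewrite integral_indic//; last exact: measurable_rV_ball.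
  rewrite -wq (EFinM (w k)); apply: lee_pmul; rewrite ?lee_fin//.
  rewrite -(lebesgue_rV_ball x)//; apply: le_measure; rewrite ?inE//.
    by apply: measurableI => //; exact: measurable_rV_ball.
  exact: measurable_rV_ball.
by rewrite sumEFin lee_fin; exact: geometric_le_lim.
Qed.

(** * Almost everywhere statements and L^p membership *)

(** The product measure of a null set is the integral of the measures of its sections, and a
    nonnegative function with zero integral vanishes a.e. *)
Lemma ae_prod_xsection d1 d2 (T1 : measurableType d1) (T2 : measurableType d2)
    (R : realType) (m1 : {sigma_finite_measure set T1 -> \bar R})
    (m2 : {sigma_finite_measure set T2 -> \bar R}) (P : T1 * T2 -> Prop) :
  (\forall z \ae (m1 \x m2)%E, P z) ->
  \forall x \ae m1, \forall y \ae m2, P (x, y).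
Proof.
move=> [A [mA A0 PA]].
have : ae_eq m1 setT (m2 \o xsection A) (cst 0%E).
  apply/(ae_eq_integral_abs m1 measurableT).
    exact: measurable_fun_xsection.
  rewrite -[RHS]A0; apply: eq_integral => x _ /=.
  by rewrite gee0_abs.
apply: filterS => x /(_ Logic.I) /= Ax0; exists (xsection A x); split => //.
  exact: measurable_xsection.
by move=> y /= Pxy; rewrite /xsection /= inE; exact: PA.
Qed.

Section Lp_membership.
Context d (T : measurableType d) (R : realType).
Variables (mu : {sigma_finite_measure set T -> \bar R}) (D : set T).
Hypothesis mD : measurable D.

Lemma Lp_measurable p (f : T -> R) : Lp mu D p f -> measurable_fun D f.
Proof.
rewrite /Lp /= inE => /andP[+ _]; rewrite inE /= => mf.
by apply/(measurable_restrictT _ mD).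
Qed.

Lemma Lp1P (f : T -> R) : Lp mu D 1 f <-> mu.-integrable D (EFin \o f).
Proof.
rewrite (integrable_mkcond _ mD) restrict_EFin.
exact: Lfun1_integrable.
Qed.

Lemma bounded_Lp (r C : R) (f : T -> R) : 0 < r -> (mu D < +oo)%E ->
  measurable_fun D f -> (\forall x \ae mu, D x -> `|f x| <= C) ->
  Lp mu D r%:E f.
Proof.
move=> r0 muD mf fC; rewrite /Lp /= inE; apply/andP; split; rewrite inE /=.
  by apply/(measurable_restrictT _ mD).
rewrite /finite_norm unlock /= poweR_lty//.
have mfr : measurable_fun setT (fun x => `|(f \_ D) x| `^ r).
  apply: (measurableT_comp (measurable_powR r)); apply: measurableT_comp => //.
  by apply/(measurable_restrictT _ mD).
pose h : T -> \bar R := EFin \o cst (C `^ r).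
apply: (@le_lt_trans _ _ (\int[mu]_x (h \_ D) x)%E).
  apply: ae_ge0_le_integral => //.
  - exact/measurable_EFinP/mfr.
  - by move=> x _; rewrite patchE; case: ifP => // _; rewrite lee_fin powR_ge0.
  - by apply/(measurable_restrictT _ mD); exact/measurable_EFinP.
  move: fC; apply: filterS => x fC _; rewrite /= !patchE.
  case: ifPn => [/set_mem Dx|_]; last first.
    by rewrite normr0 powR0 ?gt_eqF.
  rewrite lee_fin.
  by rewrite ge0_ler_powR ?nnegrE ?(ltW r0)// ?fC// (le_trans _ (fC Dx)).
rewrite -integral_mkcond.
rewrite (_ : h = cst (C `^ r)%:E)// integral_cst//= lte_mul_pinfty ?lee_fin ?powR_ge0//.
Qed.

Lemma Lp_oo_bounded (f : T -> R) : Lp mu D +oo%E f ->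
  exists C : R, \forall x \ae mu, D x -> `|f x| <= C.
Proof.
rewrite /Lp /= inE => /andP[_]; rewrite inE /= /finite_norm unlock /=.
case: ifPn => [mu0 foo|].
  have := ess_sup_ge mu (abse \o (EFin \o (f \_ D))).
  case: (ess_sup _ _) foo => [c _ fc|//|_ fc]; [exists c|exists 0];
    by move: fc; apply: filterS => x + Dx; rewrite /= patchE mem_set.
(* If [mu] is the zero measure, the norm is 0 by convention and any bound holds a.e. *)
rewrite -leNgt measure_le0 => /eqP mu0 _; exists 0.
exists setT; split => //.
Qed.

Lemma ae_eq_Rintegral (f g : T -> R) : measurable_fun D f -> measurable_fun D g ->
  f = g %[ae mu in D] -> \int[mu]_(x in D) f x = \int[mu]_(x in D) g x.
Proof.
move=> mf mg fg; congr fine; apply: ae_eq_integral => //.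
- exact/measurable_EFinP/mf.
- exact/measurable_EFinP/mg.
by move: fg; apply: filterS => x fg Dx; rewrite fg.
Qed.

(** For test functions psi = chi(t) Phi, the quotient psi / Phi is constant in space. Only an
    inequality holds in general: on a null [D] the norm is 0. *)
Lemma const_Lp_oo (c : R) : Lp mu D +oo%E (fun=> c) /\
  pnorm mu D +oo%E (fun=> c) <= `|c|.
Proof.
have mc : measurable_fun setT ((fun=> c) \_ D : T -> R) by apply/(measurable_restrictT _ mD).
have bd : ('N[mu]_+oo[EFin \o ((fun=> c) \_ D)] <= `|c|%:E)%E.
  rewrite unlock /=; case: ifPn => // _; apply/ess_supP; apply: aeW => x /=.
  by rewrite lee_fin patchE; case: ifP => // _; rewrite normr0.
split.
  rewrite /Lp /= inE; apply/andP; split; rewrite inE //=.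
  by rewrite /finite_norm (le_lt_trans bd)// ltry.
rewrite /pnorm -lee_fin fineK// ge0_fin_numE ?Lnorm_ge0//.
by rewrite (le_lt_trans bd)// ltry.
Qed.

End Lp_membership.

(** * The Green operator tested against the eigenfunction *)

Section green_operator.
Context d (T : measurableType d) (R : realType).
Variables (mu : {sigma_finite_measure set T -> \bar R}) (D : set T).
Variables (G : T -> T -> R).
Hypothesis mD : measurable D.
Hypothesis mG : measurable_fun (D `*` D) (fun z : T * T => G z.1 z.2).

(** Integrability of [G x y * f y] is not known here. Positive and negative parts are handled
    separately by Tonelli, and [fine] of their difference is measurable even where it is
    infinite. *)
Lemma measurable_kernel_op (f : T -> R) : measurable_fun D f ->
  measurable_fun D (kernel_op mu D G f).
Proof.
move=> mf; pose h (z : T * T) : R := (fun z => G z.1 z.2 * f z.2) \_ (D `*` D) z.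
have mh : measurable_fun setT h.
  apply/(measurable_restrictT _ (measurableX mD mD)).
  apply: measurable_funM => //.
  apply: (@measurable_comp _ _ _ _ _ _ D) => //; first by move=> _ [z [_ ?] <-].
  exact: (measurable_funS measurableT).
pose F (z : T * T) : \bar R := (Num.max (h z) 0)%:E.
pose H (z : T * T) : \bar R := (Num.max (- h z) 0)%:E.
have mF : measurable_fun setT (fubini_F mu F).
  apply: measurable_fun_fubini_tonelli_F => [|z].
    by apply/measurable_EFinP; apply: measurable_maxr.
  by rewrite lee_fin le_max lexx orbT.
have mH : measurable_fun setT (fubini_F mu H).
  apply: measurable_fun_fubini_tonelli_F => [|z].
    apply/measurable_EFinP; apply: measurable_maxr => //.
    exact: measurableT_comp.
  by rewrite lee_fin le_max lexx orbT.
apply: (@eq_measurable_fun _ _ _ _ _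
  (fun x => fine (fubini_F mu F x - fubini_F mu H x))); last first.
  apply: (measurable_funS measurableT) => //.
  by apply: measurableT_comp => //; exact: emeasurable_funB.
move=> x /set_mem Dx; rewrite /kernel_op /Rintegral integral_mkcond.
congr fine; rewrite [RHS]integralE /fubini_F.
congr (_ - _)%E; apply: eq_integral => y _.
- rewrite funeposE /F /h !patchE in_setX (mem_set Dx) /=; case: ifPn => _;
    by rewrite EFin_max.
- rewrite funenegE /H /h !patchE in_setX (mem_set Dx) /=; case: ifPn => _;
    by rewrite EFin_max.
Qed.

Hypothesis G_ge0 : \forall z \ae (mu \x mu)%E, D z.1 -> D z.2 -> 0 <= G z.1 z.2.

(* A kernel that is nonnegative and measurable everywhere, so that Tonelli's
   theorem applies to it. *)
Definition pos_kernel (z : T * T) : R :=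
  ((fun z => Num.max (G z.1 z.2) 0) \_ (D `*` D)) z.

Lemma pos_kernel_ge0 z : 0 <= pos_kernel z.
Proof. by rewrite /pos_kernel patchE; case: ifP => // _; rewrite le_max lexx orbT. Qed.

Lemma measurable_pos_kernel : measurable_fun setT pos_kernel.
Proof.
apply/(measurable_restrictT _ (measurableX mD mD)).
exact: measurable_maxr.
Qed.

Lemma measurable_pos_kernel_section x : measurable_fun setT (fun y => pos_kernel (x, y)).
Proof. exact: (measurableT_comp measurable_pos_kernel (pair1_measurable x)). Qed.

Lemma ae_pos_kernelE : \forall x \ae mu, D x ->
  \forall y \ae mu, D y -> pos_kernel (x, y) = G x y.
Proof.
move: (ae_prod_xsection G_ge0); apply: filterS => x + Dx; apply: filterS => y Gxy Dy.
by rewrite /pos_kernel patchE in_setX !mem_set//= max_l// Gxy.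
Qed.

(** Extended-valued version of [kernel_op], so that limits can be taken before finiteness is
    known. *)
Definition green (f : T -> R) (x : T) : \bar R :=
  (\int[mu]_(y in D) (pos_kernel (x, y) * f y)%:E)%E.

Lemma measurable_green (f : T -> R) : measurable_fun D f ->
  (forall y, D y -> 0 <= f y) -> measurable_fun setT (green f).
Proof.
move=> mf f0; pose h (z : T * T) : \bar R := (pos_kernel z * (f \_ D) z.2)%:E.
rewrite (_ : green f = fubini_F mu h).
  apply: measurable_fun_fubini_tonelli_F => [|z].
    apply/measurable_EFinP; apply: measurable_funM.
      exact: measurable_pos_kernel.
    by apply: measurableT_comp => //; apply/(measurable_restrictT _ mD).
  rewrite lee_fin mulr_ge0 ?pos_kernel_ge0// patchE.
  by case: ifPn => // /set_mem; exact: f0.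
apply/funext => x; rewrite /green integral_mkcond; apply: eq_integral => y _.
by rewrite /h !patchE /=; case: ifPn; rewrite ?mulr0.
Qed.

Lemma green_ge0 (f : T -> R) x : (forall y, D y -> 0 <= f y) -> (0 <= green f x)%E.
Proof.
move=> f0; apply: integral_ge0 => y Dy.
by rewrite lee_fin mulr_ge0 ?pos_kernel_ge0 ?f0.
Qed.

Lemma ae_kernel_opE (f g : T -> R) : measurable_fun D f -> measurable_fun D g ->
  f = g %[ae mu in D] ->
  \forall x \ae mu, D x -> kernel_op mu D G f x = fine (green g x).
Proof.
move=> mf mg fg; move: ae_pos_kernelE; apply: filterS => x + Dx => /(_ Dx) Gx.
congr fine; apply: ae_eq_integral => //.
- apply/measurable_EFinP; apply: measurable_funM => //.
  apply: (@measurable_comp _ _ _ _ _ _ (D `*` D)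
    (fun z : T * T => G z.1 z.2) D (fun y => (x, y))) => //.
  + exact: measurableX.
  + by move=> _ [y Dy <-].
  + by apply: (measurable_funS measurableT) => //; exact: pair1_measurable.
- apply/measurable_EFinP; apply: measurable_funM => //.
  by apply: (measurable_funS measurableT) => //; exact: measurable_pos_kernel_section.
by move: Gx fg; apply: filterS2 => y Gx fg Dy; rewrite Gx// fg.
Qed.

End green_operator.

(** Monotone convergence: [f] being finite, the truncation at level n equals [f] at a given point
    for all large n. *)
Lemma cvg_integral_truncation d (T : measurableType d) (R : realType)
    (mu : {measure set T -> \bar R}) (D : set T) (c f : T -> R) :
  measurable D -> measurable_fun D c -> measurable_fun D f ->
  (forall y, D y -> 0 <= c y) -> (forall y, D y -> 0 <= f y) ->
  (fun n : nat => \int[mu]_(y in D) (c y * Num.min (f y) n%:R)%:E)%E @ \oo -->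
  (\int[mu]_(y in D) (c y * f y)%:E)%E.
Proof.
move=> mD mc mf c0 f0.
rewrite (_ : integral _ _ _ = \int[mu]_(y in D)
    limn (fun n : nat => (c y * Num.min (f y) n%:R)%:E))%E; last first.
  apply: eq_integral => y _; apply/esym/lim_near_cst => //.
  have := nbhs_infty_ger (f y); apply: filterS => n fn.
  by rewrite min_l.
apply: cvg_monotone_convergence => //.
- move=> n; apply/measurable_EFinP; apply: measurable_funM => //.
  exact: measurable_minr.
- by move=> n y Dy; rewrite lee_fin mulr_ge0 ?c0// le_min f0 /=.
- move=> y Dy n k nk; rewrite lee_fin ler_wpM2l ?c0//.
  by rewrite le_min ge_min lexx /= ge_min ler_nat nk orbT.
Qed.

Lemma bounded_measurable_integrable d (T : measurableType d) (R : realType)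
    (mu : {sigma_finite_measure set T -> \bar R}) (D : set T) (C : R) (f : T -> R) :
  measurable D -> (mu D < +oo)%E -> measurable_fun D f ->
  (\forall x \ae mu, D x -> `|f x| <= C) -> mu.-integrable D (EFin \o f).
Proof.
move=> mD muD mf fC; apply/Lp1P => //.
exact: (bounded_Lp mD ltr01 muD mf fC).
Qed.

Section green_eigenfunction.
Context d (T : measurableType d) (R : realType).
Variables (mu : {sigma_finite_measure set T -> \bar R}) (D : set T).
Variables (dom : set (T -> R)) (L : (T -> R) -> (T -> R)) (G : T -> T -> R).
Variables (lam : R) (Phi : T -> R) (M : R).
Hypothesis mD : measurable D.
Hypothesis muD : (mu D < +oo)%E.
Hypothesis domL1 : forall f, dom f -> Lp mu D 1 f /\ Lp mu D 1 (L f).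
Hypothesis Lsym : selfadjoint_nonneg mu D dom L.
Hypothesis LG : inverse_kernel mu D dom L G.
Hypothesis LPhi : first_eigenpair mu D dom L lam Phi.
Hypothesis G_ge0 : \forall z \ae (mu \x mu)%E, D z.1 -> D z.2 -> 0 <= G z.1 z.2.
Hypothesis G_row : \forall x \ae mu, D x ->
  (\int[mu]_(y in D) (pos_kernel D G (x, y))%:E <= M%:E)%E.

Let mG : measurable_fun (D `*` D) (fun z : T * T => G z.1 z.2).
Proof. by case: LG. Qed.

Let lam0 : 0 < lam. Proof. by case: LPhi. Qed.

Let mPhi : measurable_fun D Phi.
Proof. by case: LPhi => _ [/domL1[+ _] _] _ _ _; exact: Lp_measurable. Qed.

(** A version of [Phi] that is nonnegative everywhere, as pointwise monotonicity arguments
    require. *)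
Let p x := Num.max (Phi x) 0.

Let p0 x : 0 <= p x. Proof. by rewrite /p le_max lexx orbT. Qed.

Let mp : measurable_fun D p. Proof. exact: measurable_maxr. Qed.

Let Phip : \forall x \ae mu, D x -> Phi x = p x.
Proof.
by case: LPhi => _ _ [_ +] _ _; apply: filterS => x + Dx; rewrite /p => /(_ Dx)/max_l.
Qed.

Let Phi_bounded : exists C : R, \forall x \ae mu, D x -> `|Phi x| <= C.
Proof. by case: LPhi => _ _ [+ _] _ _; exact: Lp_oo_bounded. Qed.

Let dom2_Phi : dom2 mu D dom L Phi.
Proof.
have [C PhiC] := Phi_bounded; case: LPhi => _ [dPhi LPhiE] _ _ _.
split => //; first exact: (bounded_Lp mD (ltr0n _ 2) muD mPhi PhiC).
have [_ L1] := domL1 dPhi.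
apply: (bounded_Lp mD (C := lam * C) (ltr0n _ 2) muD (Lp_measurable mD L1)).
move: LPhiE PhiC; apply: filterS2 => x LPhix PhiC Dx.
by rewrite LPhix// normrM gtr0_norm// ler_wpM2l ?(ltW lam0)// PhiC.
Qed.

(** With h = L^-1 g, the integral of g Phi is the inner product of L h and Phi, that is of h and L
    Phi = lam Phi. The work is to show that h is bounded, hence in [dom2]. *)
Lemma green_eigen_bounded (g : T -> R) (k : R) : measurable_fun D g ->
  (forall x, D x -> 0 <= g x <= k) ->
  (\int[mu]_(x in D) (green mu D G g x * (p x)%:E) =
   lam^-1%:E * \int[mu]_(x in D) (p x * g x)%:E)%E.
Proof.
move=> mg gk; have [C PhiC] := Phi_bounded.
have g0 x : D x -> 0 <= g x by move=> /gk /andP[].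
have gbd : \forall x \ae mu, D x -> `|g x| <= k.
  by apply: aeW => x Dx; rewrite ger0_norm ?g0//; case/andP: (gk x Dx).
have pbd : \forall x \ae mu, D x -> p x <= C.
  move: PhiC Phip; apply: filterS2 => x PhiC pE Dx; rewrite -pE//.
  exact: le_trans (ler_norm _) (PhiC Dx).
pose h := kernel_op mu D G g.
have gL1 : Lp mu D 1 g := bounded_Lp mD ltr01 muD mg gbd.
have [dh Lh] : dom h /\ L h = g %[ae mu in D] by case: LG => _ + _ => /(_ _ gL1)[].
have green_bd : \forall x \ae mu, D x -> (green mu D G g x <= (k * M)%:E)%E.
  move: G_row; apply: filterS => x GM Dx.
  apply: (@le_trans _ _ (\int[mu]_(y in D) (k%:E * (pos_kernel D G (x, y))%:E)))%E.
    apply: ge0_le_integral => //.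
    - by move=> y Dy; rewrite lee_fin mulr_ge0 ?pos_kernel_ge0 ?g0.
    - apply/measurable_EFinP; apply: measurable_funM => //.
      by apply: (measurable_funS measurableT) => //; exact: measurable_pos_kernel_section.
    - apply/measurable_EFinP; apply: measurable_funM => //.
      by apply: (measurable_funS measurableT) => //; exact: measurable_pos_kernel_section.
    - move=> y Dy; rewrite -EFinM lee_fin mulrC ler_wpM2r ?pos_kernel_ge0//.
      by case/andP: (gk y Dy).
  have k0 : 0 <= k by have /andP[gx xk] := gk x Dx; exact: le_trans gx xk.
  rewrite ge0_integralZl//.
  - by rewrite EFinM lee_wpmul2l ?lee_fin// GM.
  - apply/measurable_EFinP.
    by apply: (measurable_funS measurableT) => //; exact: measurable_pos_kernel_section.
  - by move=> y _; rewrite lee_fin pos_kernel_ge0.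
have hE : \forall x \ae mu, D x -> h x = fine (green mu D G g x).
  by apply: ae_kernel_opE => //; exact: ae_eq_refl.
have mh : measurable_fun D h := Lp_measurable mD (domL1 dh).1.
have mLh : measurable_fun D (L h) := Lp_measurable mD (domL1 dh).2.
have hbd : \forall x \ae mu, D x -> `|h x| <= k * M.
  move: hE green_bd; apply: filterS2 => x + gb Dx => -> //.
  have := green_ge0 mu G x g0; have := gb Dx.
  case: (green _ _ _ _ _) => [r|//|//] /=; rewrite !lee_fin => rk r0.
  by rewrite ger0_norm.
have dom2h : dom2 mu D dom L h.
  split => //; first exact: (bounded_Lp mD (ltr0n _ 2) muD mh hbd).
  apply: (bounded_Lp mD (ltr0n _ 2) (C := k) muD mLh).
  by move: Lh gbd; apply: filterS2 => x + gb Dx => ->//; exact: gb.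
have LPhiE : L Phi = (fun x => lam * Phi x) %[ae mu in D] by case: LPhi => _ [].
have [_ Phi2 _] := dom2_Phi.
have lPhi2 : Lp mu D 2%:E (fun x => lam * Phi x).
  apply: (bounded_Lp mD (ltr0n _ 2) (C := lam * C) muD); first exact: measurable_funM.
  move: PhiC; apply: filterS => x PhiC Dx.
  by rewrite normrM gtr0_norm// ler_wpM2l ?(ltW lam0)// PhiC.
(* The pair (Phi, lam Phi) is in the graph of L, hence in that of its adjoint: the right-to-left
   direction of the second clause of [selfadjoint_nonneg]. *)
have : inner mu D (L h) Phi = inner mu D h (fun x => lam * Phi x).
  case: Lsym => _ + _ => /(_ _ _ Phi2 lPhi2)[_]; apply => //.
rewrite /inner.
rewrite (@ae_eq_Rintegral _ _ _ mu D mD _ (fun x => p x * g x)); last 3 first.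
- exact: measurable_funM.
- exact: measurable_funM.
- by move: Lh Phip; apply: filterS2 => x + + Dx => -> // ->//; rewrite mulrC.
rewrite (@ae_eq_Rintegral _ _ _ mu D mD
    (fun x => h x * (lam * Phi x)) (fun x => lam * (p x * h x))); last 3 first.
- by apply: measurable_funM => //; exact: measurable_funM.
- by apply: measurable_funM => //; exact: measurable_funM.
- by move: Phip; apply: filterS => x + Dx => ->//; ring.
have ph_int : mu.-integrable D (EFin \o (fun x => p x * h x)).
  apply: (@bounded_measurable_integrable _ _ _ _ _ (C * (k * M))) => //.
    exact: measurable_funM.
  move: hbd pbd; apply: filterS2 => x hb pb Dx.
  by rewrite normrM ler_pM ?hb// ger0_norm ?pb.
have pg_int : mu.-integrable D (EFin \o (fun x => p x * g x)).
  apply: (@bounded_measurable_integrable _ _ _ _ _ (C * k)) => //.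
    exact: measurable_funM.
  move: gbd pbd; apply: filterS2 => x gb pb Dx.
  by rewrite normrM ler_pM ?gb// ger0_norm ?pb.
rewrite RintegralZl// => E.
transitivity (\int[mu]_(x in D) (p x * h x)%:E)%E.
  apply: ae_eq_integral => //.
  - apply: emeasurable_funM; last exact/measurable_EFinP.
    by apply: (measurable_funS measurableT) => //; exact: measurable_green.
  - by apply/measurable_EFinP; exact: measurable_funM.
  move: hE green_bd; apply: filterS2 => x hE gb Dx.
  rewrite hE// mulrC EFinM fineK// ge0_fin_numE; last exact: green_ge0.
  by rewrite (le_lt_trans (gb Dx))// ltry.
have phf := integrable_fin_num mD ph_int.
have pgf := integrable_fin_num mD pg_int.
rewrite -(fineK phf) -(fineK pgf) -EFinM; congr EFin.
by rewrite [X in lam^-1 * X]E mulrA mulVf ?mul1r// gt_eqF.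
Qed.

(** On the left, monotone convergence acts twice, in y at fixed x and then in x; on the right, once.
    Both sides may be infinite. *)
Lemma green_eigen (f : T -> R) : measurable_fun D f ->
  (forall x, D x -> 0 <= f x) ->
  (\int[mu]_(x in D) (green mu D G f x * (p x)%:E) =
   lam^-1%:E * \int[mu]_(x in D) (p x * f x)%:E)%E.
Proof.
move=> mf f0; pose g n x := Num.min (f x) n%:R.
have mg n : measurable_fun D (g n) by exact: measurable_minr.
have g0 n x : D x -> 0 <= g n x by move=> Dx; rewrite le_min f0/=.
have pker x : measurable_fun D (fun y => pos_kernel D G (x, y)).
  by apply: (measurable_funS measurableT) => //; exact: measurable_pos_kernel_section.
have green_cvg x : green mu D G (g n) x @[n --> \oo] --> green mu D G f x.
  by apply: cvg_integral_truncation => // y _; exact: pos_kernel_ge0.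
have lhs : (fun n => \int[mu]_(x in D) (green mu D G (g n) x * (p x)%:E))%E @ \oo -->
    (\int[mu]_(x in D) (green mu D G f x * (p x)%:E))%E.
  rewrite (_ : integral _ _ (fun x => green mu D G f x * _)%E = \int[mu]_(x in D)
      limn (fun n => green mu D G (g n) x * (p x)%:E))%E; last first.
    by apply: eq_integral => x _; apply/esym/cvg_lim => //; exact: cvgeZr.
  apply: cvg_monotone_convergence => //.
  - move=> n; apply: emeasurable_funM; last exact/measurable_EFinP.
    apply: (measurable_funS measurableT) => //.
    by apply: measurable_green => //; exact: g0.
  - move=> n x Dx; apply: mule_ge0; last by rewrite lee_fin.
    by apply: green_ge0; exact: g0.
  - move=> x Dx n k nk; apply: lee_wpmul2r; first by rewrite lee_fin.
    apply: ge0_le_integral => //.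
    + by move=> y Dy; rewrite lee_fin mulr_ge0 ?pos_kernel_ge0 ?g0.
    + by apply/measurable_EFinP; exact: measurable_funM.
    + by apply/measurable_EFinP; exact: measurable_funM.
    + move=> y Dy; rewrite lee_fin ler_wpM2l ?pos_kernel_ge0//.
      by rewrite le_min ge_min lexx /= ge_min ler_nat nk orbT.
apply: (cvg_unique _ lhs) => //.
rewrite (_ : (fun n => _) = (fun n => lam^-1%:E *
    \int[mu]_(x in D) (p x * g n x)%:E)%E); last first.
  apply/funext => n; apply: (green_eigen_bounded (k := n%:R)) => // x Dx.
  by rewrite g0//= ge_min lexx orbT.
apply: cvgeZl => //; exact: cvg_integral_truncation.
Qed.

(** Real-valued form for the weak equation, with [a] the time derivative of the test function;
    integrability of f Phi makes both sides finite. *)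
Lemma integral_kernel_op_eigen (f : T -> R) (a : R) : measurable_fun D f ->
  (\forall x \ae mu, D x -> 0 <= f x) -> Lp mu D 1 (f \* Phi) ->
  \int[mu]_(x in D) (kernel_op mu D G f x * (a * Phi x)) =
  a * (lam^-1 * wnorm mu D Phi f).
Proof.
move=> mf f0 fPhi; pose fp x := Num.max (f x) 0.
have mfp : measurable_fun D fp by exact: measurable_maxr.
have fp0 x : 0 <= fp x by rewrite /fp le_max lexx orbT.
have ffp : f = fp %[ae mu in D].
  by move: f0; apply: filterS => x f0 Dx; rewrite /fp max_l// f0.
have pfp_int : (\int[mu]_(x in D) (p x * fp x)%:E)%E \is a fin_num.
  rewrite (@ae_eq_integral _ _ _ _ _ (EFin \o (f \* Phi)))//.
  - by apply: integrable_fin_num => //; exact/Lp1P.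
  - by apply/measurable_EFinP; exact: measurable_funM.
  - by apply/measurable_EFinP; exact: measurable_funM.
  by move: ffp Phip; apply: filterS2 => x + + Dx => /= -> // ->//; rewrite mulrC.
have wE : wnorm mu D Phi f = fine (\int[mu]_(x in D) (p x * fp x)%:E)%E.
  apply: ae_eq_Rintegral => //.
  - by apply: measurable_funM => //; exact: measurableT_comp.
  - exact: measurable_funM.
  move: ffp Phip; apply: filterS2 => x + + Dx => -> // ->//.
  by rewrite ger0_norm// mulrC.
pose I x := (green mu D G fp x * (p x)%:E)%E.
have I0 x : (0 <= I x)%E by rewrite mule_ge0 ?lee_fin ?green_ge0.
have mI : measurable_fun D I.
  apply: emeasurable_funM; last exact/measurable_EFinP.
  by apply: (measurable_funS measurableT) => //; exact: measurable_green.
have IE : (\int[mu]_(x in D) I x = (lam^-1 * wnorm mu D Phi f)%:E)%E.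
  by rewrite EFinM wE fineK//; exact: green_eigen.
have Iint : mu.-integrable D I.
  apply/integrableP; split => //.
  by under eq_integral do rewrite gee0_abs//; rewrite IE ltry.
have mfI : measurable_fun D (fine \o I) by exact: measurableT_comp.
have fIint : mu.-integrable D (EFin \o (fine \o I)).
  apply: le_integrable Iint => //; first exact/measurable_EFinP.
  by move=> x Dx /=; case: (I x) => [r| |] //=; rewrite leey.
rewrite (@ae_eq_Rintegral _ _ _ mu D mD _ (fun x => a * (fine \o I) x)).
- rewrite RintegralZl//; congr (_ * _); apply: EFin_inj; rewrite -IE.
  rewrite /Rintegral fineK; last exact: integrable_fin_num.
  apply: ae_eq_integral => //; first exact/measurable_EFinP.
  by apply: filterS (integrable_ae mD Iint) => x Ifin Dx /=; rewrite fineK// Ifin.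
- apply: measurable_funM; first exact: measurable_kernel_op.
  exact: measurable_funM.
- exact: measurable_funM.
have kE := ae_kernel_opE mD mG G_ge0 mf mfp ffp.
move: kE Phip; apply: filterS2 => x + + Dx => -> // ->//=.
rewrite /I mulrCA; congr (a * _); have := green_ge0 mu G x (fun y (_ : D y) => fp0 y).
(* Where [green] is infinite, its [fine] is 0; its product with [p x] is 0 or +oo, and [fine] sends
   both to 0, so the two sides still agree. *)
case: (green _ _ _ _ _) => [r|_|]//=.
rewrite mul0r; have [->|px0] := eqVneq (p x) 0; first by rewrite mule0.
by rewrite gt0_mulye// lte_fin lt_def px0 p0.
Qed.

End green_eigenfunction.

(** * Test functions in time *)

Section quadratic_remainder.
Context (R : realType) (f : R -> R) (t g C : R).
Hypothesis fg : forall h, `|f (t + h) - f t - h * g| <= C * h ^+ 2.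

Lemma quotient_cvg_of_remainder :
  (fun h => `|(f (t + h) - f t) / h - g|) @ 0^' --> (0 : R).
Proof.
apply: (@squeeze_cvgr _ _ _ _ (fun=> 0) (fun h => C * `|h|)).
- near=> h; have h0 : h != 0 by near: h; exact: nbhs_dnbhs_neq.
  rewrite normr_ge0 /= -(@ler_pM2r _ `|h|) ?normr_gt0//.
  have -> : `|(f (t + h) - f t) / h - g| * `|h| = `|f (t + h) - f t - h * g|.
    by rewrite -normrM mulrBl mulfVK// [g * h]mulrC.
  by rewrite (le_trans (fg h))// -mulrA -expr2 real_normK// num_real.
- exact: cvg_cst.
- rewrite -[X in _ --> X](mulr0 C); apply: cvgM; first exact: cvg_cst.
  by rewrite -[X in _ --> X](@normr0 _ R); apply: cvg_within_filter; exact: norm_continuous.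
Unshelve. all: by end_near. Qed.

Lemma is_derive_of_remainder : is_derive t 1 f g.
Proof.
have H : (fun h => h^-1 *: ((f \o shift t) (h *: 1) - f t)) @ 0^' --> g.
  apply/subr_cvg0/norm_cvg0P.
  apply: cvg_trans quotient_cvg_of_remainder; apply: near_eq_cvg; near=> h.
  by rewrite /= [h *: 1]mulr1 [h + t]addrC [_ *: _]mulrC.
by apply: DeriveDef; [apply/cvg_ex; exists g|apply: cvg_lim].
Unshelve. all: by end_near. Qed.

End quadratic_remainder.

Section bump.
Context (R : realType).
Implicit Types x y h e a : R.

(* [spline e] is a C^1 quadratic spline from 0 (on y <= 0) to 1 (on 2e <= y),
   whose derivative is the tent function [tent e]. *)
Let sq y := Num.max y 0 ^+ 2.

Definition spline e y := (sq y - 2 * sq (y - e) + sq (y - 2 * e)) / (2 * e ^+ 2).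

Definition tent e y :=
  (Num.max y 0 - 2 * Num.max (y - e) 0 + Num.max (y - 2 * e) 0) / e ^+ 2.

(** The derivative of [sq] is twice the positive part, which is 2-Lipschitz; the bound also holds
    across the kink. *)
Let sq_remainder y h : `|sq (y + h) - sq y - h * (2 * Num.max y 0)| <= h ^+ 2.
Proof.
rewrite /sq ler_norml.
by case: (leP y 0) => y0; case: (leP (y + h) 0) => yh0; apply/andP; split; nra.
Qed.

(** Three remainders of [sq] with weights 1, 2, 1 add up to at most 4 h^2, divided by 2 e^2. A bound
    valid for all [h] avoids any case distinction at the knots. *)
Lemma spline_remainder e y h : 0 < e ->
  `|spline e (y + h) - spline e y - h * tent e y| <= 2 / e ^+ 2 * h ^+ 2.
Proof.
move=> e0; rewrite /spline /tent.
have e2 : 0 < e ^+ 2 by rewrite exprn_gt0.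
have A := sq_remainder y h.
have B := sq_remainder (y - e) h.
have D := sq_remainder (y - 2 * e) h.
rewrite -[y - e + h]addrAC -[y - 2 * e + h]addrAC in B D.
move: A B D; rewrite /sq.
set m0 := Num.max y 0; set m1 := Num.max (y - e) 0; set m2 := Num.max (y - 2 * e) 0.
set n0 := Num.max (y + h) 0; set n1 := Num.max (y + h - e) 0.
set n2 := Num.max (y + h - 2 * e) 0.
move=> A B D.
have -> : (n0 ^+ 2 - 2 * n1 ^+ 2 + n2 ^+ 2) / (2 * e ^+ 2) -
    (m0 ^+ 2 - 2 * m1 ^+ 2 + m2 ^+ 2) / (2 * e ^+ 2) -
    h * ((m0 - 2 * m1 + m2) / e ^+ 2) =
  ((n0 ^+ 2 - m0 ^+ 2 - h * (2 * m0)) - 2 * (n1 ^+ 2 - m1 ^+ 2 - h * (2 * m1)) +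
   (n2 ^+ 2 - m2 ^+ 2 - h * (2 * m2))) / (2 * e ^+ 2).
  by field; rewrite gt_eqF.
rewrite normrM [X in _ * X]gtr0_norm ?invr_gt0 ?mulr_gt0//.
rewrite ler_pdivrMr ?mulr_gt0//.
have -> : 2 / e ^+ 2 * h ^+ 2 * (2 * e ^+ 2) = 4 * h ^+ 2.
  by field; rewrite gt_eqF.
move: A B D; rewrite !ler_norml => /andP[A1 A2] /andP[B1 B2] /andP[D1 D2].
by apply/andP; split; lra.
Qed.

Lemma continuous_tent e : continuous (tent e).
Proof.
have cmax (c : R) : continuous (fun y : R => Num.max (y - c) 0).
  move=> y; apply: (@continuous_max R R (fun y => y - c) (fun=> 0)); last exact: cvg_cst.
  by apply: cvgB => //; exact: cvg_cst.
move=> y; apply: cvgM; last exact: cvg_cst.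
apply: cvgD; last exact: cmax.
apply: cvgB; first by rewrite -{2}[y]subr0; under eq_fun do rewrite -[X in Num.max X]subr0; exact: cmax.
by apply: cvgM; [exact: cvg_cst|exact: cmax].
Qed.

Lemma tent_ge0 e y : 0 < e -> 0 <= tent e y.
Proof.
move=> e0; rewrite /tent divr_ge0 ?exprn_ge0 ?(ltW e0)//.
by case: (leP y 0) => ?; case: (leP (y - e) 0) => ?; case: (leP (y - 2 * e) 0) => ?; lra.
Qed.

Lemma tent_eq0 e y : 0 < e -> y <= 0 \/ 2 * e <= y -> tent e y = 0.
Proof.
move=> e0 ye; rewrite /tent; apply/eqP; rewrite mulf_eq0; apply/orP; left; apply/eqP.
by case: (leP y 0) => ?; case: (leP (y - e) 0) => ?; case: (leP (y - 2 * e) 0) => ?;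
  case: ye => ?; lra.
Qed.

Lemma spline_eq0 e y : 0 < e -> y <= 0 -> spline e y = 0.
Proof.
move=> e0 y0; rewrite /spline /sq !max_r ?expr0n/=; try lra.
Qed.

Lemma spline_eq1 e y : 0 < e -> 2 * e <= y -> spline e y = 1.
Proof.
move=> e0 y0; rewrite /spline /sq !max_l; try lra.
by field; rewrite gt_eqF.
Qed.

Lemma spline_itv e y : 0 < e -> 0 <= spline e y <= 1.
Proof.
move=> e0; have e2 : 0 < 2 * e ^+ 2 by rewrite mulr_gt0// exprn_gt0.
rewrite /spline ler_pdivlMr// ler_pdivrMr// mul0r mul1r /sq.
by case: (leP y 0) => ?; case: (leP (y - e) 0) => ?; case: (leP (y - 2 * e) 0) => ?;
  apply/andP; split; nra.
Qed.

End bump.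

Section time.
Context (R : realType).
Local Notation leb := (@lebesgue_measure R).

Lemma continuous_integrable_itv (f : R -> R) (a b : R) : continuous f ->
  leb.-integrable `]a, b[ (EFin \o f).
Proof.
move=> cf; apply: (@integrableS _ (measurableTypeR R) R leb `[a, b]%classic) => //.
  exact: subset_itv_oo_cc.
apply: continuous_compact_integrable; first exact: segment_compact.
exact: continuous_subspaceT.
Qed.

(** The shifted spline is a primitive; it is 0 at 0 because [0 <= a], and 1 at [b] because
    [a + 2 * e <= b]. *)
Lemma Rintegral_tent (e a b : R) : 0 < e -> 0 <= a -> a + 2 * e <= b ->
  \int[leb]_(x in `]0, b[) tent e (x - a) = 1.
Proof.
move=> e0 a0 ab; have b0 : 0 < b by lra.
have ct : continuous (fun x : R => tent e (x - a)).
  move=> x; apply: (@continuous_comp _ _ _ (fun x => x - a) (tent e)).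
    by apply: cvgB => //; exact: cvg_cst.
  exact: continuous_tent.
have dS (x : R) : is_derive x (1 : R) (fun x : R => spline e (x - a) : R) (tent e (x - a)).
  apply: is_derive_of_remainder => h.
  by rewrite [x + h - a]addrAC; exact: spline_remainder.
have cS (x : R) : {for x, continuous (fun x : R => spline e (x - a) : R)}.
  apply: differentiable_continuous; apply/derivable1_diffP; exact: ex_derive.
have tint := continuous_integrable_itv (0 : R) b ct.
rewrite Rintegral_itv_obnd_cbnd//.
rewrite Rintegral_itv_bndo_bndc; last first.
  apply: (@integrableS _ (measurableTypeR R) R leb `[0, b]%classic) => //.
    exact: subset_itv_co_cc.
  apply: continuous_compact_integrable; first exact: segment_compact.
  exact: continuous_subspaceT.
rewrite /Rintegral (@continuous_FTC2 _ _ (fun x => spline e (x - a)))//.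
- by rewrite spline_eq1 ?spline_eq0//=; lra.
- exact: continuous_subspaceT.
- split; first by move=> x _; exact: ex_derive.
  + by apply: cvg_at_right_filter; exact: cS.
  + by apply: cvg_at_left_filter; exact: cS.
- by move=> x _; rewrite derive1E; exact: derive_val.
Qed.

End time.

(** * The scalar differential inequality *)

Section decay.
Context (R : realType) (Y Z : R -> R) (lam T kap m : R).
Local Notation leb := (@lebesgue_measure R).
Implicit Types e a b c r s t y : R.
Hypothesis lam0 : 0 < lam.
Hypothesis Ycont : forall t, 0 < t -> {for t, continuous Y}.
Hypothesis YT : forall t, T <= t -> Y t = 0.
Hypothesis Z0 : forall t, 0 < t -> 0 <= Z t.
Hypothesis ZT : forall t, T <= t -> Z t = 0.
Hypothesis Zint : forall b, leb.-integrable `]0, b[ (EFin \o Z).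
(** Stated for any positive [y] above [Y t], so that a single [y] serves for all later times,
    including those where Y vanishes. *)
Hypothesis ZY : forall t y, 0 < t -> 0 < y -> Y t <= y -> Z t <= kap * y `^ m.
(** Weak form of Y' = - lam Z for a test function rising on [a, a + 2e] and falling on [r, r + 2e];
    the time horizon lies strictly beyond its support. *)
Hypothesis YZ : forall e a r, 0 < e -> 0 < a -> a + 2 * e <= r ->
  \int[leb]_(t in `]0, r + 2 * e + 1[)
    ((tent e (t - a) - tent e (t - r)) * (lam^-1 * Y t)) =
  \int[leb]_(t in `]0, r + 2 * e + 1[)
    ((spline e (t - a) - spline e (t - r)) * Z t).

Let continuous_tent_sub e a : continuous (fun t : R => tent e (t - a) : R).
Proof.
move=> x; apply: (@continuous_comp _ _ _ (fun x => x - a) (tent e)).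
  by apply: cvgB => //; exact: cvg_cst.
exact: continuous_tent.
Qed.

(** Y is controlled only for positive times, but the tent vanishes up to [a > 0], so the product is
    continuous on the whole line. *)
Let continuous_tentY e a : 0 < e -> 0 < a -> continuous (fun t : R => tent e (t - a) * Y t).
Proof.
move=> e0 a0 t; have [ta|at_] := ltP t a.
  have : \forall s \near t, tent e (s - a) * Y s = 0.
    have := lt_nbhsl ta; apply: filterS => s sa.
    by rewrite tent_eq0 ?mul0r//; left; rewrite subr_le0 ltW.
  exact: near_cst_continuous.
apply: cvgM; first exact: continuous_tent_sub.
by apply: Ycont; exact: lt_le_trans at_.
Qed.

Let tentY_le e a b c : 0 < e -> 0 < a -> a + 2 * e <= b ->
  (forall t, a <= t <= a + 2 * e -> Y t <= c) ->
  \int[leb]_(t in `]0, b[) (tent e (t - a) * Y t) <= c.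
Proof.
move=> e0 a0 ab Yc.
have tint := continuous_integrable_itv 0 b (@continuous_tent_sub e a).
rewrite -[leRHS]mulr1 -(Rintegral_tent e0 (ltW a0) ab) -RintegralZl//.
apply: le_Rintegral => //.
- exact/continuous_integrable_itv/continuous_tentY.
- by apply: continuous_integrable_itv => t; apply: cvgM; [exact: cvg_cst|exact: continuous_tent_sub].
move=> t _; rewrite [leRHS]mulrC.
have [t1|t1] := leP t a; first by rewrite tent_eq0 ?mul0r//; left; rewrite subr_le0.
have [t2|t2] := leP (a + 2 * e) t; first by rewrite tent_eq0 ?mul0r//; right; lra.
by rewrite ler_wpM2l ?tent_ge0// Yc// !ltW.
Qed.

Let tentY_ge e a b c : 0 < e -> 0 < a -> a + 2 * e <= b ->
  (forall t, a <= t <= a + 2 * e -> c <= Y t) ->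
  c <= \int[leb]_(t in `]0, b[) (tent e (t - a) * Y t).
Proof.
move=> e0 a0 ab Yc.
have tint := continuous_integrable_itv 0 b (@continuous_tent_sub e a).
rewrite -[leLHS]mulr1 -(Rintegral_tent e0 (ltW a0) ab) -RintegralZl//.
apply: le_Rintegral => //.
- by apply: continuous_integrable_itv => t; apply: cvgM; [exact: cvg_cst|exact: continuous_tent_sub].
- exact/continuous_integrable_itv/continuous_tentY.
move=> t _; rewrite [leLHS]mulrC.
have [t1|t1] := leP t a; first by rewrite tent_eq0 ?mul0r//; left; rewrite subr_le0.
have [t2|t2] := leP (a + 2 * e) t; first by rewrite tent_eq0 ?mul0r//; right; lra.
by rewrite ler_wpM2l ?tent_ge0// Yc// !ltW.
Qed.

(** Smoothed form of Y(a) - Y(r) = lam times the integral of Z from a to r. *)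
Let tentY_sub e a r : 0 < e -> 0 < a -> a + 2 * e <= r ->
  \int[leb]_(t in `]0, r + 2 * e + 1[) (tent e (t - a) * Y t) -
  \int[leb]_(t in `]0, r + 2 * e + 1[) (tent e (t - r) * Y t) =
  lam * \int[leb]_(t in `]0, r + 2 * e + 1[)
    ((spline e (t - a) - spline e (t - r)) * Z t).
Proof.
move=> e0 a0 ar; have r0 : 0 < r by lra.
rewrite -YZ// -RintegralB//; try exact/continuous_integrable_itv/continuous_tentY.
transitivity (lam * (lam^-1 * \int[leb]_(t in `]0, r + 2 * e + 1[)
    (tent e (t - a) * Y t - tent e (t - r) * Y t))).
  by rewrite mulrA mulfV ?mul1r// gt_eqF.
congr (_ * _); rewrite -RintegralZl//.
  by apply: eq_Rintegral => t _; ring.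
by apply: continuous_integrable_itv => t; apply: cvgB; exact: continuous_tentY.
Qed.

Let continuous_spline_sub e a : 0 < e -> continuous (fun t : R => spline e (t - a)).
Proof.
move=> e0 t; apply: differentiable_continuous; apply/derivable1_diffP.
apply: (@ex_derive _ _ _ _ _ _ (tent e (t - a))); apply: is_derive_of_remainder => h.
by rewrite [t + h - a]addrAC; exact: spline_remainder.
Qed.

(** The first spline has reached 1 before the second one leaves 0. *)
Let spline_sub_itv e a r t : 0 < e -> a + 2 * e <= r ->
  0 <= spline e (t - a) - spline e (t - r) <= 1.
Proof.
move=> e0 ar; have /andP[] := spline_itv (t - a) e0; have /andP[] := spline_itv (t - r) e0.
have [tr|tr] := leP t r; first by rewrite (spline_eq0 (y := t - r))//; lra.
by rewrite (spline_eq1 (y := t - a))//; lra.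
Qed.

(** If Y increased from t to r, the average of Y just after t would be smaller than the one just
    after r, whereas their difference is an integral of a nonnegative function. *)
Lemma decay_nonincreasing t r : 0 < t -> t <= r -> Y r <= Y t.
Proof.
move=> t0; rewrite le_eqVlt => /predU1P[<-//|tr].
rewrite leNgt; apply/negP => Ytr; have r0 := lt_trans t0 tr.
(* Two levels cutting the gap between [Y t] and [Y r] into thirds. *)
pose c := (Y t * 2 + Y r) / 3; pose c' := (Y t + Y r * 2) / 3.
have cc : c < c' by rewrite /c /c'; lra.
have nt : \forall s \near t, Y s < c.
  by apply: (cvgr_lt (Y t) (Ycont t0)); rewrite /c; lra.
have nr : \forall s \near r, c' < Y s.
  by apply: (cvgr_gt (Y r) (Ycont r0)); rewrite /c'; lra.
have [d1 /= d10 B1] : nbhs_ball t [set s | Y s < c] by rewrite nbhs_ballE.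
have [d2 /= d20 B2] : nbhs_ball r [set s | c' < Y s] by rewrite nbhs_ballE.
(* Dividing by 3 keeps the windows of length 2e strictly inside both balls and disjoint. *)
pose e := Num.min (Num.min d1 d2) (r - t) / 3.
have dd : 0 < Num.min (Num.min d1 d2) (r - t) by rewrite !lt_min d10 d20 subr_gt0.
have e0 : 0 < e by rewrite divr_gt0.
have [ed1 ed2 ert] : [/\ 3 * e <= d1, 3 * e <= d2 & 3 * e <= r - t].
  by rewrite /e mulrC mulfVK ?pnatr_eq0//; split; rewrite !ge_min lexx ?orbT.
have tr2 : t + 2 * e <= r by lra.
have P1 := @tentY_le e t (r + 2 * e + 1) c e0 t0.
have P2 := @tentY_ge e r (r + 2 * e + 1) c' e0 r0.
have E := tentY_sub e0 t0 tr2.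
have : 0 <= lam * \int[leb]_(t0 in `]0, r + 2 * e + 1[)
    ((spline e (t0 - t) - spline e (t0 - r)) * Z t0).
  rewrite mulr_ge0 ?(ltW lam0)// Rintegral_ge0// => s; rewrite /= in_itv => /andP[s0 _].
  by rewrite mulr_ge0 ?Z0//; case/andP: (@spline_sub_itv e t r s e0 tr2).
rewrite -E; apply/negP; rewrite -ltNge subr_lt0.
apply: (le_lt_trans (P1 _ _)); [lra| |apply: (lt_le_trans cc); apply: P2; [lra|]].
- move=> s /andP[s1 s2]; apply/ltW/B1; rewrite /ball /= ltr_norml; apply/andP; split; lra.
- move=> s /andP[s1 s2]; apply/ltW/B2; rewrite /ball /= ltr_norml; apply/andP; split; lra.
Qed.

Lemma decay_step t : 0 < t < T -> 0 < Y t -> Y t <= lam * (kap * Y t `^ m) * (T - t).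
Proof.
move=> /andP[t0 tT] Yt0; set y := Y t.
have Z_le s : t <= s -> Z s <= kap * y `^ m.
  move=> ts; apply: ZY => //; first exact: lt_le_trans ts.
  exact: decay_nonincreasing.
have K0 : 0 <= kap * y `^ m by apply: le_trans (Z_le t _); rewrite ?Z0.
(* The average over [t, t + 2e] is at least [Y b] as soon as t + 2e <= b; continuity of Y at t then
   lets b tend to t. *)
have key b : t < b -> Y b <= lam * (kap * y `^ m) * (T - t).
  move=> tb; pose e := Num.min (b - t) (T - t) / 2.
  have dd : 0 < Num.min (b - t) (T - t) by rewrite lt_min !subr_gt0 tb.
  have e0 : 0 < e by rewrite divr_gt0.
  have [eb eT] : 2 * e <= b - t /\ 2 * e <= T - t.
    by rewrite /e mulrC mulfVK ?pnatr_eq0//; split; rewrite ge_min lexx ?orbT.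
  have tT2 : t + 2 * e <= T by lra.
  have T0 : 0 < T by lra.
  have := tentY_sub e0 t0 tT2.
  (* With r = T the second average vanishes: Y is 0 from T on, and the tent is 0 before. *)
  rewrite [X in _ - X](_ : _ = 0) ?subr0; last first.
    transitivity (\int[leb]_(t in `]0, T + 2 * e + 1[) (0 : R)).
      apply: eq_Rintegral => s _; have [sT|Ts] := leP s T; last by rewrite YT ?mulr0// ltW.
      by rewrite tent_eq0 ?mul0r//; left; lra.
    by rewrite Rintegral_cst// mul0r.
  move=> E; apply: (@le_trans _ _ (\int[leb]_(s in `]0, T + 2 * e + 1[) (tent e (s - t) * Y s))).
    apply: tentY_ge => //; first lra.
    by move=> s /andP[ts ste]; apply: decay_nonincreasing; lra.
  rewrite E -mulrA ler_wpM2l ?(ltW lam0)//.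
  have mb : (leb `]0%R, (T + 2 * e + 1)%R[%classic < +oo)%E.
    by rewrite lebesgue_measure_itv; case: ifP => // _; exact: ltry.
  have leE : (leb `[t, T]%classic = (T - t)%:E)%E.
    by rewrite lebesgue_measure_itv/= lte_fin tT.
  have ind_int (c : R) : leb.-integrable `]0, T + 2 * e + 1[
      (EFin \o (fun s => c * \1_(`[t, T]%classic) s)).
    apply: (@bounded_measurable_integrable _ _ _ leb _ `|c|) => //.
      by apply: measurable_funM => //; exact: measurable_indic.
    apply: aeW => s _; rewrite normrM ler_piMr// indicE.
    by case: (_ \in _); rewrite ?normr1 ?normr0.
  (* The integrand is dominated by a constant on [t, T]: before t both splines vanish, after T it is
     Z that does. *)
  have -> : kap * y `^ m * (T - t) =
      \int[leb]_(s in `]0, T + 2 * e + 1[) (kap * y `^ m * \1_(`[t, T]%classic) s).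
    rewrite RintegralZl//; last first.
      rewrite (_ : \1__ = (fun s => 1 * \1_(`[t, T]%classic) s)); first exact: ind_int.
      by apply/funext => s; rewrite mul1r.
    rewrite /Rintegral integral_indic//; congr (_ * _).
    rewrite setIidl; last by apply: subset_itvSoo; rewrite bnd_simp//; lra.
    by rewrite -[LHS]/(fine (T - t)%:E); congr fine; rewrite -leE.
  apply: le_Rintegral => //.
    apply: (@le_integrable _ (measurableTypeR R) R leb _ _ _ (EFin \o Z)) => //.
    + apply/measurable_EFinP; apply: measurable_funM; last first.
        by have := measurable_int leb (Zint (T + 2 * e + 1)); move/measurable_EFinP.
      apply: (measurable_funS measurableT) => //; apply: continuous_measurable_fun.
      by move=> s; apply: cvgB; exact: continuous_spline_sub.
    + move=> s; rewrite /= in_itv /= => /andP[s0 _]; rewrite lee_fin normrM ler_piMl//.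
      by have /andP[c0 c1] := @spline_sub_itv e t T s e0 tT2; rewrite ger0_norm.
  move=> s; rewrite /= in_itv => /andP[s0 sT]; have /andP[c0 c1] := @spline_sub_itv e t T s e0 tT2.
  have [st|ts] := ltP s t.
    rewrite !spline_eq0 ?subrr ?mul0r//; [|lra..].
    by rewrite mulr_ge0.
  have [Ts|Ts] := leP T s; first by rewrite ZT// mulr0 mulr_ge0.
  rewrite indicE mem_set ?mulr1/= ?in_itv/= ?ts ?(ltW Ts)//.
  rewrite (le_trans _ (Z_le s ts))// ler_piMl// Z0//.
apply/ler_addgt0Pr => eps eps0.
have : \forall s \near t, y - eps < Y s.
  by apply: (cvgr_gt (Y t) (Ycont t0)); rewrite ltrBlDr ltrDl.
move=> [d /= d0 Bd].
have /Bd : ball_ Num.Def.normr t d (t + d / 2).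
  by rewrite /= ltr_norml; apply/andP; split; lra.
have /key : t < t + d / 2 by rewrite ltrDl divr_gt0.
by move=> h1 h2; lra.
Qed.

Lemma decay_bound P t : 0 < m < 1 -> 0 < P -> kap = P `^ (1 - m) -> 0 < t < T ->
  0 <= Y t ->
  Y t <= lam `^ (1 / (1 - m)) * P * (T - t) `^ (1 / (1 - m)).
Proof.
move=> /andP[m0 m1] P0 kapE /andP[t0 tT] Yt0.
have T0 : 0 < T - t by rewrite subr_gt0.
have rhs0 : 0 <= lam `^ (1 / (1 - m)) * P * (T - t) `^ (1 / (1 - m)).
  by rewrite !mulr_ge0 ?powR_ge0 ?(ltW P0).
have [<-//|Yt] := eqVneq 0 (Y t).
have {Yt0 Yt}Yt : 0 < Y t by rewrite lt_def eq_sym Yt.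
have om0 : 0 < 1 - m by rewrite subr_gt0.
have omV : (1 - m) * (1 / (1 - m)) = 1 by rewrite mul1r mulfV ?gt_eqF.
have step : Y t `^ (1 - m) <= lam * kap * (T - t).
  rewrite powRB ?(gt_eqF Yt) ?implybT// powRr1 ?(ltW Yt)//.
  rewrite ler_pdivrMr ?powR_gt0//.
  have := @decay_step t; rewrite t0 tT => /(_ isT Yt).
  by move/le_trans; apply; rewrite le_eqVlt; apply/orP; left; apply/eqP; ring.
have := @ge0_ler_powR R (1 / (1 - m)) _ (Y t `^ (1 - m)) (lam * kap * (T - t)) _ _ step.
rewrite -powRrM omV powRr1 ?(ltW Yt)// => H.
apply: (le_trans (H _ _ _)).
- by rewrite divr_ge0 ?(ltW om0).
- by rewrite nnegrE powR_ge0.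
- by rewrite nnegrE (le_trans _ step)// powR_ge0.
rewrite kapE !powRM ?mulr_ge0 ?powR_ge0 ?(ltW lam0) ?(ltW T0)//.
by rewrite -[(P `^ _) `^ _]powRrM omV powRr1 ?(ltW P0).
Qed.

End decay.

(** * The weighted norm *)

(** Young's inequality with exponents 1/m and 1/(1-m), applied to (r/c)^m and 1, then multiplied by
    c^m. *)
Lemma powR_tangent (R : realType) (m c r : R) : 0 < m < 1 -> 0 < c -> 0 <= r ->
  r `^ m <= m * c `^ (m - 1) * r + (1 - m) * c `^ m.
Proof.
move=> /andP[m0 m1] c0 r0; have om0 : 0 < 1 - m by rewrite subr_gt0.
have rc0 : 0 <= r / c by rewrite divr_ge0// ltW.
have := @conjugate_powR R ((r / c) `^ m) 1 m^-1 (1 - m)^-1.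
rewrite !invrK powR_ge0 ler01 !invr_gt0 m0 om0 mulr1 powR1 mul1r addrC subrK.
rewrite -powRrM mulfV ?gt_eqF// powRr1// => /(_ isT isT isT isT erefl) H.
have cm0 : 0 < c `^ m by exact: powR_gt0.
move: H; rewrite -(ler_pM2r cm0) -powRM ?(ltW c0)// divfK ?gt_eqF//.
move=> /le_trans; apply; rewrite powRB ?(gt_eqF c0) ?implybT// powRr1 ?(ltW c0)//.
by rewrite le_eqVlt; apply/orP; left; apply/eqP; field; rewrite gt_eqF.
Qed.

Lemma norm_spow (R : realType) (m r : R) : 0 < m -> `|spow m r| = `|r| `^ m.
Proof.
move=> m0; rewrite /spow normrM ger0_norm ?powR_ge0// mulrC.
by rewrite mulr_powRB1.
Qed.

Lemma pnorm1E d (T : measurableType d) (R : realType)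
    (mu : {sigma_finite_measure set T -> \bar R}) (D : set T) (f : T -> R) :
  pnorm mu D 1 f = \int[mu]_(x in D) `|f x|.
Proof.
rewrite /pnorm Lnorm1 /Rintegral [in RHS]integral_mkcond; congr fine.
by apply: eq_integral => x _; rewrite /= !patchE; case: ifP => // _; rewrite normr0.
Qed.

Section weighted_norm.
Context d (T : measurableType d) (R : realType).
Variables (mu : {sigma_finite_measure set T -> \bar R}) (D : set T).
Variable Phi : T -> R.
Implicit Types (f g : T -> R) (c y : R).
Hypothesis mD : measurable D.
Hypothesis mPhi : measurable_fun D Phi.
Hypothesis Phi0 : \forall x \ae mu, D x -> 0 <= Phi x.

Lemma wnormE f : measurable_fun D f ->
  wnorm mu D Phi f = \int[mu]_(x in D) (`|f x| * `|Phi x|).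
Proof.
move=> mf; apply: ae_eq_Rintegral => //.
- by apply: measurable_funM => //; exact: measurableT_comp.
- by apply: measurable_funM => //; exact: measurableT_comp.
by move: Phi0; apply: filterS => x + Dx => /(_ Dx) P0; rewrite (ger0_norm P0).
Qed.

Lemma wnorm_ge0 f : measurable_fun D f -> 0 <= wnorm mu D Phi f.
Proof. by move=> mf; rewrite wnormE// Rintegral_ge0// => x _; rewrite mulr_ge0. Qed.

Lemma L1w_integrable f : L1w mu D Phi f ->
  mu.-integrable D (EFin \o (fun x => `|f x| * `|Phi x|)).
Proof.
move=> [mf /(Lp1P _ mD) fPhi].
have := integrable_norm fPhi; apply: eq_integrable => // x _ /=.
by rewrite normrM.
Qed.

Lemma wnorm_ae_eq0 f : measurable_fun D f -> f = (fun=> 0) %[ae mu in D] ->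
  wnorm mu D Phi f = 0.
Proof.
move=> mf f0; rewrite wnormE// (@ae_eq_Rintegral _ _ _ mu D mD _ (fun=> 0)).
- by rewrite Rintegral_cst// mul0r.
- by apply: measurable_funM; exact: measurableT_comp.
- exact: measurable_cst.
by move: f0; apply: filterS => x + Dx => ->//; rewrite normr0 mul0r.
Qed.

(** Transfers continuity of u in the weighted space to the scalar function Y. *)
Lemma wnorm_dist f g : L1w mu D Phi f -> L1w mu D Phi g ->
  `|wnorm mu D Phi f - wnorm mu D Phi g| <= wnorm mu D Phi (f \- g).
Proof.
move=> Lf Lg; have [mf _] := Lf; have [mg _] := Lg.
have fi := L1w_integrable Lf; have gi := L1w_integrable Lg.
have mfg : measurable_fun D (f \- g) by exact: measurable_funB.
have fgi : mu.-integrable D (EFin \o (fun x => `|f x - g x| * `|Phi x|)).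
  apply: (@le_integrable _ _ _ mu D _ _
    (EFin \o (fun x => `|f x| * `|Phi x| + `|g x| * `|Phi x|))) => //.
  - apply/measurable_EFinP; apply: measurable_funM; exact: measurableT_comp.
  - move=> x Dx; rewrite lee_fin -mulrDl !normrM !normr_id ler_wpM2r//.
    by rewrite [leRHS]ger0_norm ?addr_ge0// ler_normB.
  - by have := integrableD mD fi gi; apply: eq_integrable.
have fgi' : mu.-integrable D (EFin \o
    (fun x => `|f x| * `|Phi x| - `|g x| * `|Phi x|)).
  by have := integrableB mD fi gi; apply: eq_integrable.
rewrite !wnormE// -RintegralB//.
apply: le_trans (le_normr_Rintegral mD fgi') _.
apply: le_Rintegral => //; first exact: integrable_norm.
by move=> x _; rewrite -mulrBl normrM normr_id ler_wpM2r// ler_dist_dist.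
Qed.

Section spow.
Variables (m P : R).
Hypothesis m01 : 0 < m < 1.
Hypothesis PhiP : Lp mu D 1 Phi.

Let measurable_spow f : measurable_fun D f -> measurable_fun D (fun x => spow m (f x)).
Proof.
move=> mf; apply: measurable_funM => //.
apply: (measurableT_comp (measurable_powR (m - 1))).
exact: measurableT_comp.
Qed.

Let spow_le c f x : 0 < c -> `|spow m (f x)| * `|Phi x| <=
  m * c `^ (m - 1) * (`|f x| * `|Phi x|) + (1 - m) * c `^ m * `|Phi x|.
Proof.
move=> c0; have /andP[m0 _] := m01; rewrite norm_spow// mulrA -mulrDl ler_wpM2r//.
exact: powR_tangent.
Qed.

Let spow_bound_integrable c f : L1w mu D Phi f -> mu.-integrable D (EFin \o
  (fun x => m * c `^ (m - 1) * (`|f x| * `|Phi x|) + (1 - m) * c `^ m * `|Phi x|)).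
Proof.
move=> Lf; have fi := L1w_integrable Lf.
have Pi : mu.-integrable D (EFin \o (fun x => `|Phi x|)).
  by apply: integrable_norm; exact/Lp1P.
have := integrableD mD (integrableZl mD (m * c `^ (m - 1)) fi)
  (integrableZl mD ((1 - m) * c `^ m) Pi).
exact: eq_integrable.
Qed.

(** The tangent at c = 1 dominates, Phi being integrable. This gives membership at every time, where
    the definition of solution gives it for almost every one. *)
Lemma L1w_spow f : L1w mu D Phi f -> L1w mu D Phi (fun x => spow m (f x)).
Proof.
move=> Lf; have [mf _] := Lf; split; first exact: measurable_spow.
apply/Lp1P => //; apply: le_integrable (spow_bound_integrable 1 Lf) => //.
  by apply/measurable_EFinP; apply: measurable_funM => //; exact: measurable_spow.
move=> x Dx; rewrite lee_fin normrM (le_trans (spow_le f x ltr01))//.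
exact: ler_norm.
Qed.

(* Jensen's inequality, from the tangent to r `^ m at the mean value y / P1. *)
Lemma wnorm_spow_le f y : L1w mu D Phi f -> 0 < y -> wnorm mu D Phi f <= y ->
  0 < pnorm mu D 1 Phi ->
  wnorm mu D Phi (fun x => spow m (f x)) <= pnorm mu D 1 Phi `^ (1 - m) * y `^ m.
Proof.
move=> Lf y0 fy; have [mf _] := Lf; set P1 := pnorm _ _ _ _ => P0.
have PE : P1 = \int[mu]_(x in D) `|Phi x| by exact: pnorm1E.
have c0 : 0 < y / P1 by rewrite divr_gt0.
have /andP[m0 m1] := m01.
have fi := L1w_integrable Lf.
have Pi : mu.-integrable D (EFin \o (fun x => `|Phi x|)).
  by apply: integrable_norm; exact/Lp1P.
rewrite wnormE; last exact: measurable_spow.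
apply: (@le_trans _ _ (\int[mu]_(x in D) (m * (y / P1) `^ (m - 1) * (`|f x| * `|Phi x|) +
   (1 - m) * (y / P1) `^ m * `|Phi x|))).
  apply: le_Rintegral => //.
  - exact: (L1w_integrable (L1w_spow Lf)).
  - exact: spow_bound_integrable.
  - by move=> x _; exact: spow_le.
rewrite RintegralD//.
- rewrite !RintegralZl// -wnormE// -PE.
  apply: (@le_trans _ _ (m * (y / P1) `^ (m - 1) * y + (1 - m) * (y / P1) `^ m * P1)).
    by rewrite lerD2r ler_wpM2l// mulr_ge0 ?powR_ge0// ltW.
  (* At c = y / P1 both terms are multiples of y^m P1^(1-m), with coefficients m and 1 - m: the
     bound is exact. *)
  rewrite !powRB ?(gt_eqF c0) ?(gt_eqF P0) ?implybT// !powRr1 ?(ltW c0) ?(ltW P0)//.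
  rewrite powRM ?invr_ge0 ?(ltW y0) ?(ltW P0)// -powR_inv1 ?(ltW P0)// -powRrM mulN1r powRN.
  have Pm : 0 < P1 `^ m by exact: powR_gt0.
  rewrite powR_inv1 ?(ltW P0)//.
  by rewrite le_eqVlt; apply/orP; left; apply/eqP; field; rewrite !gt_eqF.
- by have := integrableZl mD (m * (y / P1) `^ (m - 1)) fi; apply: eq_integrable.
- by have := integrableZl mD ((1 - m) * (y / P1) `^ m) Pi; apply: eq_integrable.
Qed.

End spow.

(** A zero L^1 norm would make Phi vanish a.e., against its L^2 normalization. *)
Lemma pnorm1_gt0 : Lp mu D 1 Phi -> pnorm mu D 2%:E Phi = 1 -> 0 < pnorm mu D 1 Phi.
Proof.
move=> PhiL1 Phi2; rewrite lt_def fine_ge0 ?Lnorm_ge0// andbT; apply/eqP => P1.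
have : ae_eq mu D (EFin \o Phi) (cst 0%E).
  apply/(ae_eq_integral_abs mu mD); first exact/measurable_EFinP.
  have fin : (\int[mu]_(x in D) `|(EFin \o Phi) x|)%E \is a fin_num.
    apply: integrable_fin_num => //; apply: integrable_norm; exact/Lp1P.
  by rewrite -(fineK fin); congr EFin; rewrite -P1 pnorm1E.
move=> ae0; have : pnorm mu D 2%:E Phi = 0.
  rewrite /pnorm unlock (@ae_eq_integral _ _ _ _ _ (cst 0%E))//.
  - by rewrite integral0 poweR0r ?invr_eq0.
  - have mr : measurable_fun setT (Phi \_ D) by apply/(measurable_restrictT _ mD).
    apply/measurable_EFinP; apply: (measurableT_comp (measurable_powR 2)).
    exact: measurableT_comp.
  move: ae0; apply: filterS => x + _; rewrite /= patchE.
  by case: ifPn => [/set_mem Dx /(_ Dx)[->]|_ _]; rewrite normr0 powR0.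
by rewrite Phi2 => /eqP; rewrite oner_eq0.
Qed.

End weighted_norm.

(** * Decay of weak dual solutions *)

Section test_function.
Context d (T : measurableType d) (R : realType).
Variables (mu : {sigma_finite_measure set T -> \bar R}) (D : set T).
Hypothesis mD : measurable D.

Lemma pnorm_oo_cst_cvg (F : set_system R) (FF : Filter F) (f : R -> R) :
  (fun h => `|f h|) @ F --> (0 : R) ->
  (fun h => pnorm mu D +oo%E (fun=> f h)) @ F --> (0 : R).
Proof.
move=> f0; apply: squeeze_cvgr (cvg_cst 0) f0; apply: nearW => h.
rewrite (const_Lp_oo mu mD (f h)).2 andbT /pnorm.
by apply: fine_ge0; exact: Lnorm_ge0.
Qed.

(** The support [a, r + 2e] must end strictly before the horizon, hence the extra 1. *)
Lemma C1c_Loo_spline (e a r : R) : 0 < e -> 0 < a -> a + 2 * e <= r ->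
  C1c_Loo mu D (r + 2 * e + 1)
    (fun t _ => spline e (t - a) - spline e (t - r))
    (fun t _ => tent e (t - a) - tent e (t - r)).
Proof.
move=> e0 a0 ar; split.
- by move=> t; split; exact: (const_Lp_oo mu mD _).1.
- move=> t; apply: pnorm_oo_cst_cvg.
  apply: (@quotient_cvg_of_remainder _ (fun t => spline e (t - a) - spline e (t - r)) _ _
    (2 / e ^+ 2 + 2 / e ^+ 2)) => h.
  have A := spline_remainder (t - a) h e0; have B := spline_remainder (t - r) h e0.
  rewrite -[t + h - a]addrAC -[t + h - r]addrAC in A B *.
  rewrite [X in `|X|](_ : _ =
    (spline e (t - a + h) - spline e (t - a) - h * tent e (t - a)) -
    (spline e (t - r + h) - spline e (t - r) - h * tent e (t - r))); last by ring.
  by rewrite (le_trans (ler_normB _ _))// mulrDl lerD.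
- move=> t; apply: pnorm_oo_cst_cvg.
  apply/norm_cvg0P/subr_cvg0.
  have ct b : {for t, continuous (fun t : R => tent e (t - b))}.
    apply: (@continuous_comp _ _ _ (fun x => x - b) (tent e)).
      by apply: cvgB => //; exact: cvg_cst.
    exact: continuous_tent.
  by apply: cvgB; exact: ct.
exists a, (r + 2 * e); split => //; first by rewrite ltrDl.
move=> t; rewrite negb_and -!ltNge => /orP[ta|rt]; apply: aeW => x _.
  by rewrite !spline_eq0 ?subrr//; lra.
by rewrite !spline_eq1 ?subrr//; lra.
Qed.

End test_function.

Section extinction_decay.
Context d (T : measurableType d) (R : realType).
Variables (mu : {sigma_finite_measure set T -> \bar R}) (D : set T).
Variables (dom : set (T -> R)) (L : (T -> R) -> (T -> R)) (G : T -> T -> R).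
Variables (lam : R) (Phi : T -> R) (M : R).
Hypothesis mD : measurable D.
Hypothesis muD : (mu D < +oo)%E.
Hypothesis domL1 : forall f, dom f -> Lp mu D 1 f /\ Lp mu D 1 (L f).
Hypothesis Lsym : selfadjoint_nonneg mu D dom L.
Hypothesis LG : inverse_kernel mu D dom L G.
Hypothesis LPhi : first_eigenpair mu D dom L lam Phi.
Hypothesis G_ge0 : \forall z \ae (mu \x mu)%E, D z.1 -> D z.2 -> 0 <= G z.1 z.2.
Hypothesis G_row : \forall x \ae mu, D x ->
  (\int[mu]_(y in D) (pos_kernel D G (x, y))%:E <= M%:E)%E.
Variables (m Te : R) (u0 : T -> R) (u : R -> T -> R).
Hypothesis m01 : 0 < m < 1.
Hypothesis wds : WDS_CDP mu D m G Phi u0 u.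
Hypothesis u0_L1w : L1w mu D Phi u0.
Hypothesis u_ge0 : forall t, 0 < t -> \forall x \ae mu, D x -> 0 <= u t x.
Hypothesis Te0 : 0 < Te.
Hypothesis extinct : forall t, Te <= t -> u t = (fun=> 0) %[ae mu in D].

Let PhiL1 : Lp mu D 1 Phi.
Proof. by case: LPhi => _ [/domL1[]]. Qed.

Let mPhi : measurable_fun D Phi. Proof. exact: Lp_measurable PhiL1. Qed.

Let Phi0 : \forall x \ae mu, D x -> 0 <= Phi x.
Proof. by case: LPhi => _ _ []. Qed.

Let lam0 : 0 < lam. Proof. by case: LPhi. Qed.

Let P := pnorm mu D 1 Phi.

Let P0 : 0 < P. Proof. by apply: pnorm1_gt0 => //; case: LPhi. Qed.

Let u_L1w t : 0 <= t -> L1w mu D Phi (u t).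
Proof.
move=> t0; have t1 : 0 < t + 1 by rewrite ltr_wpDl.
have tin : `[0, t + 1[%classic t by rewrite /= in_itv/= t0 ltrDl ltr01.
by have [_ /(_ t tin)[]] := wds t1.
Qed.

Let Y t := wnorm mu D Phi (u t).
Let Z t := wnorm mu D Phi (fun x => spow m (u t x)).

Let Y0 t : 0 <= t -> 0 <= Y t.
Proof. by move=> /u_L1w[mu_ _]; exact: wnorm_ge0. Qed.

Let Y_dist t r : 0 <= t -> 0 <= r ->
  `|Y r - Y t| <= wnorm mu D Phi (u r \- u t).
Proof. by move=> t0 r0; apply: wnorm_dist => //; exact: u_L1w. Qed.

Let Ycont t : 0 < t -> {for t, continuous Y}.
Proof.
move=> t0; have t1 : 0 < t + 1 by rewrite addr_gt0.
have tin : `]0, t + 1[%classic t by rewrite /= in_itv/= t0 ltrDl ltr01.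
have [[+ _ _] _ _] := wds t1 => /(_ t tin)[_].
rewrite within_interior; last first.
  by apply: near_in_itvoo; exact: tin.
move=> cv; apply/subr_cvg0/norm_cvg0P; apply: squeeze_cvgr (cvg_cst 0) cv.
have := lt_nbhsr t0; apply: filterS => r r0.
by rewrite normr_ge0/= Y_dist// ltW.
Qed.

(** Stated for any right limit [v] at 0, since it serves both for [u 0], in the decay estimate at t
    = 0, and for the datum [u0], in the bound on the extinction time. *)
Let Y_initial_le (v : T -> R) (B : R) : L1w mu D Phi v ->
  (fun t => wnorm mu D Phi (u t \- v)) @ 0^'+ --> (0 : R) ->
  (forall t, 0 < t < Te -> Y t <= B) -> wnorm mu D Phi v <= B.
Proof.
move=> Lv cv YB; apply/ler_addgt0Pr => eps eps0.
have : \forall t \near 0^'+, [/\ 0 < t, t < Te & wnorm mu D Phi (u t \- v) < eps].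
  near=> t; split.
  - by near: t; exact: nbhs_right_gt.
  - by near: t; exact: nbhs_right_lt.
  - by near: t; exact: (cvgr_lt 0 cv).
move=> /filter_ex[t [t0 tT uv]].
have := wnorm_dist mD mPhi Phi0 (u_L1w (ltW t0)) Lv.
rewrite distrC => /(le_trans (ler_norm _)) H.
have := YB t; rewrite t0 tT => /(_ isT); rewrite /Y => YtB.
by move: H uv YtB; lra.
Unshelve. all: by end_near. Qed.

Let cvg_u0_right : (fun t => wnorm mu D Phi (u t \- u 0)) @ 0^'+ --> (0 : R).
Proof.
have tin : `[0, 1[%classic (0 : R) by rewrite /= in_itv/= lexx ltr01.
have [_ + _] := wds (@ltr01 R) => /(_ 0 tin)[_] cv.
apply: cvg_trans cv; apply: cvg_app => S.
move=> H; have lt01 : \forall t \near (0 : R), t < 1 by exact: lt_nbhsl ltr01.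
have {}H : \forall t \near (0 : R), `[0, 1[%classic t -> S t by exact: H.
suff : \forall t \near (0 : R), 0 < t -> S t by [].
move: H lt01; apply: filterS2 => t St t1 t0.
by apply: St; rewrite /= in_itv/= ltW.
Qed.

Let mspow t : 0 <= t -> measurable_fun D (fun x => spow m (u t x)).
Proof. by move=> t0; have [] := L1w_spow mD mPhi m01 PhiL1 (u_L1w t0). Qed.

Let Z0 t : 0 < t -> 0 <= Z t.
Proof. by move=> t0; apply: wnorm_ge0 => //; exact/mspow/ltW. Qed.

Let YT t : Te <= t -> Y t = 0.
Proof.
move=> Tt; have t0 := lt_le_trans Te0 Tt; apply: wnorm_ae_eq0 => //; last exact: extinct.
by have [] := u_L1w (ltW t0).
Qed.

Let ZT t : Te <= t -> Z t = 0.
Proof.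
move=> Tt; have t0 := lt_le_trans Te0 Tt; apply: wnorm_ae_eq0 => //; first exact/mspow/ltW.
by move: (extinct Tt); apply: filterS => x + Dx => ->//; rewrite /spow mulr0.
Qed.

Let Zint b : (@lebesgue_measure R).-integrable `]0, b[ (EFin \o Z).
Proof.
have [b0|b0] := ltP 0 b; last first.
  by rewrite set_itv_ge ?bnd_simp ?leNgt -?leNgt//; exact: integrable_set0.
have [[_ [_ zi] _] _ _] := wds b0.
apply: (@integrableS _ (measurableTypeR R) R lebesgue_measure `[0, b]%classic) => //.
exact: subset_itv_oo_cc.
Qed.

Let ZY t y : 0 < t -> 0 < y -> Y t <= y -> Z t <= P `^ (1 - m) * y `^ m.
Proof. by move=> t0 y0 Yy; apply: wnorm_spow_le => //; exact/u_L1w/ltW. Qed.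

(** The Green identity turns the left side of the weak equation into Y; on the right, u >= 0 lets
    u^m replace its absolute value. *)
Let YZ e a r : 0 < e -> 0 < a -> a + 2 * e <= r ->
  \int[lebesgue_measure]_(t in `]0, r + 2 * e + 1[)
    ((tent e (t - a) - tent e (t - r)) * (lam^-1 * Y t)) =
  \int[lebesgue_measure]_(t in `]0, r + 2 * e + 1[)
    ((spline e (t - a) - spline e (t - r)) * Z t).
Proof.
move=> e0 a0 ar; have b0 : 0 < r + 2 * e + 1 by lra.
have [[_ _ /(_ _ _ (C1c_Loo_spline mu mD e0 a0 ar)) E] _ _] := wds b0.
transitivity (\int[lebesgue_measure]_(t in `]0, r + 2 * e + 1[)
  \int[mu]_(x in D) (kernel_op mu D G (u t) x *
    ((tent e (t - a) - tent e (t - r)) * Phi x))).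
  apply: eq_Rintegral => t /set_mem; rewrite /= in_itv/= => /andP[t0 _].
  have [mu_ uPhi] := u_L1w (ltW t0).
  by rewrite (integral_kernel_op_eigen mD muD domL1 Lsym LG LPhi G_ge0 G_row)//; exact: u_ge0.
rewrite E; apply: eq_Rintegral => t /set_mem; rewrite /= in_itv/= => /andP[t0 _].
have [_ /(Lp1P _ mD) sPhi] := L1w_spow mD mPhi m01 PhiL1 (u_L1w (ltW t0)).
have ms := mspow (ltW t0).
transitivity (\int[mu]_(x in D) ((spline e (t - a) - spline e (t - r)) *
    (spow m (u t x) * Phi x))).
  by apply: eq_Rintegral => x _; ring.
rewrite RintegralZl//; congr (_ * _); apply: ae_eq_Rintegral => //.
- exact: measurable_funM.
- by apply: measurable_funM => //; exact: measurableT_comp.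
move: (u_ge0 t0); apply: filterS => x ux Dx.
by rewrite ger0_norm// /spow mulr_ge0 ?powR_ge0 ?ux.
Qed.

Let B t := lam `^ (1 / (1 - m)) * P * (Te - t) `^ (1 / (1 - m)).

Let Y_le t : 0 < t < Te -> Y t <= B t.
Proof.
move=> /andP[t0 tT].
apply: (decay_bound lam0 Ycont YT Z0 ZT Zint ZY YZ m01 P0 erefl); first by rewrite t0.
exact/Y0/ltW.
Qed.

Lemma extinction_decay :
  (forall t, 0 <= t < Te -> wnorm mu D Phi (u t) <=
     lam `^ (1 / (1 - m)) * pnorm mu D 1 Phi * (Te - t) `^ (1 / (1 - m))) /\
  lam^-1 * (wnorm mu D Phi u0 / pnorm mu D 1 Phi) `^ (1 - m) <= Te.
Proof.
(* The estimate at time 0 is a limit from positive times, for which one bound uniform in t is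
   convenient. *)
have YB0 t : 0 < t < Te -> Y t <= B 0.
  move=> tT; apply: le_trans (Y_le tT) _; rewrite ler_wpM2l ?mulr_ge0 ?powR_ge0 ?(ltW P0)//.
  case/andP: tT => t0 tT; have /andP[_ m1] := m01.
  rewrite ge0_ler_powR ?nnegrE ?divr_ge0 ?subr_ge0 ?(ltW tT) ?(ltW m1) ?(ltW Te0)//.
  by rewrite subr0 gerBl ltW.
split.
  move=> t /andP[]; rewrite le_eqVlt => /predU1P[<- _|t0 tT]; last by apply: Y_le; rewrite t0.
  by apply: Y_initial_le => //; exact: u_L1w.
have u0B : wnorm mu D Phi u0 <= B 0.
  by have [_ _ cv] := wds (@ltr01 R); apply: Y_initial_le cv YB0.
have /andP[m0 m1] := m01; have om0 : 0 < 1 - m by rewrite subr_gt0.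
have w0 : 0 <= wnorm mu D Phi u0 by case: u0_L1w => mu0 _; exact: wnorm_ge0.
have lT0 : 0 <= lam * Te by rewrite mulr_ge0 ?ltW.
have : wnorm mu D Phi u0 / P <= (lam * Te) `^ (1 / (1 - m)).
  rewrite ler_pdivrMr// (le_trans u0B)// /B subr0 powRM ?(ltW lam0) ?(ltW Te0)//.
  by rewrite le_eqVlt; apply/orP; left; apply/eqP; ring.
move=> /(ge0_ler_powR (ltW om0)) H.
rewrite ler_pdivrMl//; apply: (le_trans (H _ _)).
- by rewrite nnegrE divr_ge0// ltW.
- by rewrite nnegrE powR_ge0.
by rewrite -powRrM mul1r mulVf ?gt_eqF// powRr1.
Qed.

End extinction_decay.

(** * The abstract decay estimate on a bounded domain, with a kernel satisfying (K1) *)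

Theorem proposition3 (R : realType) (N : nat) (Omega : set 'rV[R]_N)
    (alpha s m : R)
    (dom : set ('rV[R]_N -> R)) (L : ('rV[R]_N -> R) -> ('rV[R]_N -> R))
    (G : 'rV[R]_N -> 'rV[R]_N -> R)
    (lambda1 : R) (Phi1 : 'rV[R]_N -> R)
    (u0 : 'rV[R]_N -> R) (u : R -> 'rV[R]_N -> R) (T : R)
    (hN : (1 <= N)%N)
    (halpha : 0 < alpha < 1)
    (hOmega : bounded_C2_hoelder_domain alpha Omega)
    (hs : 0 < s <= 1)
    (hNs : 2 * s < N%:R)
    (hL : densely_defined_operator (lebesgue_rV N) Omega dom L)
    (hL2 : selfadjoint_nonneg (lebesgue_rV N) Omega dom L)
    (hA1 : m_accretive (lebesgue_rV N) Omega dom L)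
    (hA2 : sub_markovian (lebesgue_rV N) Omega dom L)
    (hG : inverse_kernel (lebesgue_rV N) Omega dom L G)
    (hK1 : K1 s Omega G)
    (heig : first_eigenpair (lebesgue_rV N) Omega dom L lambda1 Phi1)
    (hm : 0 < m < 1)
    (hu0 : L1w (lebesgue_rV N) Omega Phi1 u0)
    (hu : WDS_CDP (lebesgue_rV N) Omega m G Phi1 u0 u)
    (hu_ge0 : forall t, 0 < t ->
      \forall x \ae lebesgue_rV N, Omega x -> 0 <= u t x)
    (hT : 0 < T)
    (hext : extinction_time (lebesgue_rV N) Omega u T) :
  (forall t, 0 <= t < T ->
     wnorm (lebesgue_rV N) Omega Phi1 (u t) <=
       lambda1 `^ (1 / (1 - m)) * pnorm (lebesgue_rV N) Omega 1 Phi1 *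
         (T - t) `^ (1 / (1 - m))) /\
  lambda1^-1 *
    (wnorm (lebesgue_rV N) Omega Phi1 u0 / pnorm (lebesgue_rV N) Omega 1 Phi1)
      `^ (1 - m) <= T.
Proof.
have [oO _ _ bO _] := hOmega.
have mO : measurable Omega by exact: measurable_rV_open.
have [domL1 _ _ _] := hL.
have [c [c0 Gc]] := hK1.
have G_ge0 : \forall z \ae (lebesgue_rV N \x lebesgue_rV N)%E,
    Omega z.1 -> Omega z.2 -> 0 <= G z.1 z.2.
  by move: Gc; apply: filterS => z Gz z1 z2; case/andP: (Gz z1 z2).
have b0 : 0 < N%:R - 2 * s < N%:R.
  by case/andP: hs => s0 _; rewrite subr_gt0 hNs gtrBl ?mulr_gt0//.
have [M MP] := riesz_kernel_bound b0 (ltW c0) mO bO.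
have mG : measurable_fun (Omega `*` Omega) (fun z => G z.1 z.2) by case: hG.
apply: (extinction_decay mO (lebesgue_rV_bounded mO bO) domL1 hL2 hG heig G_ge0
  (M := M) _ hm hu hu0 hu_ge0 hT); last by case: hext => -[].
(* (K1) holds a.e. on the product, hence for a.e. x it holds for a.e. y; this row-wise form is the
   input of the Riesz bound. *)
move: (ae_prod_xsection Gc) (ae_pos_kernelE G_ge0).
apply: filterS2 => x Gx GE Ox; apply: (MP x) => //.
- by apply/measurable_EFinP; exact: measurable_pos_kernel_section.
- by move=> y; rewrite lee_fin pos_kernel_ge0.
move: Gx (GE Ox); apply: filterS2 => y Gxy GxyE Oy.
by rewrite lee_fin GxyE//; case/andP: (Gxy Ox Oy).
Qed.
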